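(* For $\rho\in(0,\infty)$ and $\delta\in\mathbb R$ let $Z_{\rho,\delta}$ have cumulative distribution function $F_{\rho,\delta}(y)=\Phi(\delta+\rho\,\Phi^{-1}(y))$, $y\in(0,1)$, let $X_{a_{\rho,\delta},b_{\rho,\delta}}\sim\mathrm{Beta}(a_{\rho,\delta},b_{\rho,\delta})$ with $a_{\rho,\delta},b_{\rho,\delta}>0$ as defined in the context, and let $\mathfrak s(x):=\rho\big(x-\Phi(-\delta/\sqrt{\rho^2+1})\big)$ for $x\in\mathbb R$. Then: 1. $W_2(Z_{\rho,\delta},X_{a_{\rho,\delta},b_{\rho,\delta}})\to0$ as $\delta\to-\infty$; 2. $W_2(Z_{\rho,\delta},X_{a_{\rho,\delta},b_{\rho,\delta}})\to0$ as $\rho\to\infty$; 3. $W_2(Z_{\rho,\delta},X_{a_{\rho,\delta},b_{\rho,\delta}})\to0$ as $\rho,|\delta|\to\infty$ with $\delta/\rho=r$ fixed; 4. $W_2(Z_{\rho,\delta},X_{a_{\rho,\delta},b_{\rho,\delta}})\to0$ as $\delta\to\infty$; 5. $W_2(Z_{\rho,\delta},X_{a_{\rho,\delta},b_{\rho,\delta}})\to0$ as $\rho\to0^+$; 6. $W_2\big(\mathfrak s(Z_{\rho,\delta}),\mathfrak s(X_{a_{\rho,\delta},b_{\rho,\delta}})\big)\to0$ as $\rho\to\infty$; 7. $W_2\big(\mathfrak s(Z_{\rho,\delta}),\mathfrak s(X_{a_{\rho,\delta},b_{\rho,\delta}})\big)\to0$ as $\rho,|\delta|\to\infty$ with $\delta/\rho=r$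 fixed.
   Context: $\Phi$, $\Phi^{-1}$ are the standard normal CDF and its inverse. With $p:=\Phi(-\delta/\sqrt{\rho^2+1})$ (the mean of $Z_{\rho,\delta}$), so $1-p=\Phi(\delta/\sqrt{\rho^2+1})$, define $$a_{\rho,\delta}:=\frac{p\,[\,p(1-p)-\mathrm{Var}(Z_{\rho,\delta})\,]}{\mathrm{Var}(Z_{\rho,\delta})},\qquad b_{\rho,\delta}:=\frac{(1-p)\,[\,p(1-p)-\mathrm{Var}(Z_{\rho,\delta})\,]}{\mathrm{Var}(Z_{\rho,\delta})}.$$ These are positive since $0<\mathrm{Var}(Z_{\rho,\delta})<p(1-p)$; they are the parameters for which the beta law has the same mean and variance as $Z_{\rho,\delta}$. The 2-Wasserstein distance between (the laws of) real random variables $X,Y$ with quantile functions $F_X^{-1},F_Y^{-1}$ is $W_2(X,Y):=\sqrt{\int_0^1\{F_X^{-1}(z)-F_Y^{-1}(z)\}^2dz}$. When only one of $\rho,\delta$ is sent to a limit, the other is held fixed. The function $\mathfrak s$ depends on the current values of $\rho,\delta$. *)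

(* Defs.v *)
From HB Require Import structures.
From mathcomp Require Import all_boot all_order all_algebra.
From mathcomp Require Import all_classical all_reals all_analysis.
From mathcomp Require Import measurable_realfun.

Set Implicit Arguments.
Unset Strict Implicit.
Unset Printing Implicit Defensive.

Import Order.TTheory GRing.Theory Num.Theory.
Import numFieldNormedType.Exports.

Local Open Scope classical_set_scope.
Local Open Scope ring_scope.

Section StandardNormal.
Context {R : realType}.

Definition Phi (x : R) : R := fine (normal_prob 0 1 `]-oo, x]).

(* [Phi] is a bijection from R onto ]0, 1[; the values of [Phi_inv] outside
   ]0, 1[ are junk and never used. *)
Definition Phi_inv : R -> R := pinv [set: R] Phi.

End StandardNormal.

Section Wasserstein.
Context {R : realType}.

(* The generalized inverse of the cdf; meaningful for 0 < z < 1, where the set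
   is nonempty and bounded below. *)
Definition quantile d (T : measurableType d) (P : probability T R)
    (X : {mfun T >-> R}) (z : R) : R :=
  inf [set x : R | (z%:E <= cdf (X : {RV P >-> R}) x)%E].

(* Extended-real valued, so that an infinite integral gives distance +oo. *)
Definition W2 d1 (T1 : measurableType d1) (P : probability T1 R)
    (X : {mfun T1 >-> R}) d2 (T2 : measurableType d2) (Q : probability T2 R)
    (Y : {mfun T2 >-> R}) : \bar R :=
  sqrte (\int[lebesgue_measure]_(z in `]0%R, 1%R[)
    ((quantile P X z - quantile Q Y z) ^+ 2)%R%:E)%E.

End Wasserstein.

(* [beta_prob] of the library only covers natural number parameters. *)
Section RealBeta.
Context {R : realType}.
Implicit Types a b x : R.

Definition rbeta_kernel a b x : R := x `^ (a - 1) * (1 - x) `^ (b - 1).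

Definition rbeta_fun a b : R :=
  \int[lebesgue_measure]_(x in `]0, 1[) rbeta_kernel a b x.

Definition rbeta_pdf a b x : R :=
  (rbeta_kernel a b \_ `]0, 1[) x / rbeta_fun a b.

Definition rbeta_distributed d (T : measurableType d) (P : probability T R)
    (X : {mfun T >-> R}) a b : Prop :=
  forall A : set (measurableTypeR R), measurable A ->
    distribution P X A = (\int[lebesgue_measure]_(x in A) (rbeta_pdf a b x)%:E)%E.

End RealBeta.

Section MatchedBeta.
Context {R : realType}.
Implicit Types rho delta : R.

Definition F_cdf rho delta (y : R) : R := Phi (delta + rho * Phi_inv y).

Definition mean_p rho delta : R := Phi (- delta / Num.sqrt (rho ^+ 2 + 1)).

Context d (T : measurableType d) (P : probability T R).

Definition beta_a rho delta (Z : {mfun T >-> R}) : R :=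
  let p := mean_p rho delta in
  let v := fine 'V_P[Z] in
  p * (p * (1 - p) - v) / v.

Definition beta_b rho delta (Z : {mfun T >-> R}) : R :=
  let p := mean_p rho delta in
  let v := fine 'V_P[Z] in
  (1 - p) * (p * (1 - p) - v) / v.

End MatchedBeta.

Section Standardization.
Context {R : realType}.
Variables rho delta : R.

Definition stdz (x : R) : R := rho * (x - mean_p rho delta).

Lemma measurable_stdz : measurable_fun [set: R] stdz.
Proof. by apply: measurable_funM => //; exact: measurable_funB. Qed.

HB.instance Definition _ := @isMeasurableFun.Build _ _ _ _ stdz measurable_stdz.

End Standardization.

(* Main.v *)
Require Import Defs.
From HB Require Import structures.
From mathcomp Require Import all_boot all_order all_algebra.
From mathcomp Require Import all_classical all_reals all_analysis.
From mathcomp Require Import measurable_realfun.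
From mathcomp Require Import ring lra.

Set Implicit Arguments.
Unset Strict Implicit.
Unset Printing Implicit Defensive.

Import Order.TTheory GRing.Theory Num.Theory.
Import numFieldNormedType.Exports.

Local Open Scope classical_set_scope.
Local Open Scope ring_scope.

(** Each distance is an L2 distance over ]0, 1[ between the quantile functions
    [qZ] and [qX].  A quantile function carries the uniform law to the law of
    its variable ([integral_quantile]), so that moments, too, are averages over
    ]0, 1[ ([mean01]), and the claims become inequalities between such averages.
    Write [p] for the mean of Z, [v] for its variance, [s] for the square root
    of [v] and [M] for [p (1 - p)].

    If N is standard normal, then Z has the law of Phi ((N - delta) / rho); the
    mean of this variable is the probability that rho N' <= N - delta for an
    independent copy N' of N, which is [mean_p] ([mean_probit]).  The parameters
    of the beta law are [p n] and [(1 - p) n] with [n + 1 = M / v]; integrating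
    the derivatives of x^a (1 - x)^b and of x^(a+1) (1 - x)^b shows that X has
    mean [p] and variance [v] ([mean_beta], [variance_beta]).

    Unscaled limits.  Both variables lie at L2 distance [s] from the constant
    [p], so W2 is at most 2 s ([W2_le_variance]).  This suffices for the limits
    in delta, because [v < M] and [p] tends to 0 or to 1, and for rho to
    infinity, because [v <= rho ^- 2] uniformly in delta.  When rho tends to 0
    both laws approach the Bernoulli law of mean [p]: for any variable with
    values in ]0, 1[, the L1 distance to the Bernoulli quantile function with
    the same mean is at most twice the mean of [q (1 - q)]
    ([mean01_quantile_bernoulli]), that is, [2 (M - v)] for Z and for X alike.

    Scaled limits.  Both quantile functions are compared with [p + s m], where
    [m] is the normal quantile function; since rho s <= 1, errors of smaller
    order than 1 / rho are enough.  For Z a second-order Taylor expansion of Phi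
    gives an error of order rho ^- 2 ([probit_normal_approx]).  For X,
    [|qX - p - s m|^2 = 2 v - 2 s c] in L2 norm, where [c] is the mean of
    [(qX - p) m], so only a lower bound on the correlation [c] is needed.  Let f
    and F be the density and the cdf of X, let g be the inverse of Phi composed
    with F, so that g(X) is normal, and let H(x) be the integral of (t - p) f(t)
    for t above x, which equals f(x) x (1 - x) / n.  Integrating by parts in two
    ways,
      [c = int phi (g x) dx = int (g' x) (H x) dx],  with  [g' = f / phi (g)],
    so that by the inequality of arithmetic and geometric means
      [c >= int sqrt (f H) = E (sqrt (X (1 - X) / n))],
    and the right-hand side is close to [s] because X concentrates around [p].
    This yields [|qX - p - s m|^2 <= 2 v (s + v) / M] ([beta_normal_approx]). *)

(** * Quantile functions as changes of variables *)

Section quantile_transform.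
Context {R : realType}.
Notation mu := (@lebesgue_measure R).

Lemma eq_probability_cdf (P Q : probability R R) :
  (forall x : R, P `]-oo, x]%classic = Q `]-oo, x]%classic) ->
  forall A, measurable A -> P A = Q A.
Proof.
move=> PQ A mA.
have fin (P' : probability R R) (B : set R) : measurable B -> (P' B < +oo)%E.
  by move=> mB; rewrite -ge0_fin_numE// fin_num_measure.
apply: (@measure_unique _ R R (@ocitv R)
  (fun k => `](- k%:R), k%:R]%classic) _ _ _ _ P Q) => //.
- exact: ocitvI.
- by move=> i; exact: is_ocitv.
- apply/seteqP; split => // x _.
  exists (Num.truncn `|x|).+1 => //=; rewrite in_itv/=.
  by have := truncnS_gt `|x|; rewrite ltr_norml => /andP[-> /ltW ->].
- move=> _ [[a b]] /= _ <-.
  have [ab | ba] := leP a b; last first.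
    by rewrite set_itv_ge ?measure0// bnd_simp -leNgt ltW.
  have -> : `]a, b]%classic = `]-oo, b] `\` `]-oo, a] :> set R.
    by rewrite -[RHS]setCK setCD setCitvl setUC -[LHS]setCK setCitv.
  have mD (P' : probability R R) : (P' (`]-oo, b] `\` `]-oo, a]) =
      P' `]-oo, b]%classic - P' `]-oo, a]%classic)%E.
    by rewrite measureD ?setIidr//; [exact: subset_itvl|exact: fin].
  by rewrite !mD !PQ.
- by move=> k; exact: fin.
Qed.

Section galois.
Context d (T : measurableType d) (P : probability T R) (X : {RV P >-> R}).

Lemma cdf_fineK (x : R) : cdf X x = (fine (cdf X x))%:E.
Proof. by rewrite fineK// fin_num_measure. Qed.

(** The Galois connection between a cdf and its generalized inverse: by right
    continuity the infimum that defines the quantile is attained. *)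
Lemma quantile_le (z x : R) : 0 < z < 1 ->
  (quantile P X z <= x) = (z%:E <= cdf X x)%E.
Proof.
move=> /andP[z0 z1].
set A := [set y : R | (z%:E <= cdf X y)%E].
have A0 : A !=set0.
  apply/set0P/negP => /eqP A0.
  suff : (1 <= z%:E)%E by rewrite lee_fin leNgt z1.
  apply: cvge_to_le (cvg_cdfy1 X) _; apply: nearW => y.
  rewrite leNgt; apply/negP => zy; have : A y by exact: ltW.
  by rewrite A0.
have [b Ab] : exists b, lbound A b.
  apply/not_existsP => nb.
  suff : (z%:E <= 0)%E by rewrite lee_fin leNgt z0.
  apply: cvge_to_ge (cvg_cdfNy0 X) _; apply: nearW => y.
  rewrite leNgt; apply/negP => yz; apply: (nb y) => w Aw.
  rewrite leNgt; apply/negP => wy; move: yz; rewrite ltNge => /negP; apply.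
  by apply: (le_trans Aw); exact/cdf_nondecreasing/ltW.
have hA : has_inf A by split => //; exists b.
apply/idP/idP => [qx|zx]; last first.
  by apply: ge_inf => //; exists b.
have h : forall y, x < y -> (z%:E <= cdf X y)%E.
  move=> y xy; have /inf_lt : inf A < y by exact: le_lt_trans qx xy.
  move=> /(_ A0)[w Aw wy]; apply: (le_trans Aw); exact/cdf_nondecreasing/ltW.
apply: (cvge_to_ge (@cdf_right_continuous _ _ _ _ X x)).
near=> y; apply: h; near: y; exact: nbhs_right_gt.
Unshelve. all: by end_near. Qed.

Lemma quantile_nondecreasing : {in `]0, 1[ &, {homo quantile P X : x y / x <= y}}.
Proof.
move=> x y; rewrite !in_itv/= => x01 y01 xy; rewrite quantile_le//.
by apply: (@le_trans _ _ y%:E); [rewrite lee_fin|rewrite -quantile_le].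
Qed.

Lemma quantile_eq (z q : R) : 0 < z < 1 ->
  cdf X q = z%:E -> (forall y, y < q -> (cdf X y < z%:E)%E) -> quantile P X z = q.
Proof.
move=> z01 Xq ltz; apply/eqP; rewrite eq_le quantile_le// Xq lexx/=.
rewrite leNgt; apply/negP => /ltz; rewrite ltNge -quantile_le//.
by rewrite lexx.
Qed.

Lemma quantile_gt_cdf (z x : R) : 0 < z < 1 ->
  (x < quantile P X z) = (cdf X x < z%:E)%E.
Proof. by move=> z01; rewrite ltNge quantile_le// -ltNge. Qed.

End galois.

Section transform.
Context d (T : measurableType d) (P : probability T R) (X : {RV P >-> R}).

(* The values outside ]0, 1[ are junk; cutting them off gives a random variable
   on the whole line, as needed to speak of its law. *)
Let Q01 := quantile P X \_ `](0:R), (1:R)[.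

Lemma measurable_quantile : measurable_fun `](0:R), (1:R)[ (quantile P X).
Proof.
apply: (measurability (@RGenOInfty.G R)) => [|/= _ [_] [r] -> <-].
  exact: RGenOInfty.measurableE.
have -> : `](0:R), (1:R)[ `&` quantile P X @^-1` `]r, +oo[ =
    `](0:R), (1:R)[ `&` (`](fine (cdf X r)), +oo[ : set R).
  apply/seteqP; split => z /= [] z01; rewrite !in_itv/= !andbT.
    by rewrite quantile_gt_cdf// cdf_fineK lte_fin.
  by move=> h; split => //; rewrite quantile_gt_cdf// cdf_fineK lte_fin.
exact: measurableI.
Qed.

Let mQ01 : measurable_fun setT Q01.
Proof. by apply/(measurable_restrictT _ _).1 => //; exact: measurable_quantile. Qed.

Let mQ01_mixin := @isMeasurableFun.Build _ _ (measurableTypeR R) R Q01 mQ01.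
Let Qrv : {mfun measurableTypeR R >-> R} := HB.pack Q01 mQ01_mixin.

Let P01 : probability (measurableTypeR R) R := uniform_prob (@ltr01 R).

Let P01E (B : set (measurableTypeR R)) : measurable B -> P01 B = mu (`](0:R), (1:R)[ `&` B).
Proof.
move=> mB; transitivity (\int[P01]_x (\1_B x)%:E)%E.
  by rewrite integral_indic// setIT.
rewrite integral_uniform//; last first.
  exact/measurable_EFinP/measurable_indic.
rewrite subr0 invr1 mul1e integral_itv_bndoo//; last first.
  exact/measurable_EFinP/measurable_funTS/measurable_indic.
by rewrite integral_indic// setIC.
Qed.

(* By the Galois connection, [Q01 <= x] holds on an interval of length [cdf X x]. *)
Let law : forall A, measurable A -> distribution P01 Qrv A = distribution P X A.
Proof.
apply: eq_probability_cdf => x.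
transitivity (P01 (Q01 @^-1` `]-oo, x])) => //.
rewrite P01E; last by rewrite -[X in _ X]setTI; exact: mQ01.
rewrite -[RHS]/(cdf X x) cdf_fineK.
set c := fine (cdf X x).
have c0 : 0 <= c by rewrite fine_ge0// cdf_ge0.
have c1 : c <= 1 by rewrite -lee_fin -cdf_fineK cdf_le1.
have -> : `](0:R), (1:R)[ `&` Q01 @^-1` `]-oo, x] = `](0:R), (1:R)[ `&` `]-oo, c].
  apply/seteqP; split => z /= [] z01; rewrite !in_itv/= /Q01 patchE mem_set//.
    by rewrite quantile_le// cdf_fineK lee_fin.
  by rewrite quantile_le// cdf_fineK lee_fin.
have [c0'|c0'] := eqVneq c 0.
  rewrite [X in mu X](_ : _ = set0) ?measure0 ?c0'//.
  apply/seteqP; split => z //= []; rewrite !in_itv/= => /andP[+ _].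
  by rewrite ltNge => /negP.
have [c1'|c1'] := eqVneq c 1.
  rewrite setIidl; last by move=> z /=; rewrite !in_itv/= c1' => /andP[_ /ltW].
  by rewrite lebesgue_measure_itv/= lte01 c1' oppr0 adde0.
rewrite [X in mu X](_ : _ = `](0:R), c]%classic).
  by rewrite lebesgue_measure_itv/= lte_fin lt_neqAle eq_sym c0' c0 oppr0 adde0.
apply/seteqP; split => z /=; rewrite !in_itv/=.
  by move=> [/andP[-> _] ->].
move=> /andP[-> zc]; rewrite zc (le_lt_trans zc)// lt_neqAle c1' c1//.
Qed.

(** The quantile function of [X] transports the uniform law to the law of [X]. *)
Lemma integral_quantile (h : R -> \bar R) : measurable_fun setT h ->
  (\int[P]_w h (X w) = \int[mu]_(z in `]0%R, 1%R[) h (quantile P X z))%E.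
Proof.
have ge0 (g : R -> \bar R) : measurable_fun setT g -> (forall x, 0 <= g x)%E ->
    (\int[P]_w g (X w) = \int[mu]_(z in `]0%R, 1%R[) g (quantile P X z))%E.
  move=> mg g0.
  rewrite -[LHS](@ge0_integral_distribution _ _ _ _ _ P X g)//.
  transitivity (\int[distribution P01 Qrv]_y g y)%E.
    by apply: eq_measure_integral => A mA _; exact/esym/law.
  rewrite ge0_integral_distribution//= integral_uniform//; last first.
    exact: measurableT_comp.
  rewrite subr0 invr1 mul1e integral_itv_bndoo//; last first.
    exact/measurable_funTS/measurableT_comp.
  by apply: eq_integral => z z01; rewrite /= /Q01 patchE z01.
move=> mh; rewrite integralE [RHS]integralE; congr (_ - _)%E.
  rewrite (funepos_comp h X) (funepos_comp h (quantile P X)).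
  by apply: ge0 => //; exact: measurable_funepos.
rewrite (funeneg_comp h X) (funeneg_comp h (quantile P X)).
by apply: ge0 => //; exact: measurable_funeneg.
Qed.

(** The Radon-Nikodym derivative of the law of [X] is almost everywhere [f],
    since both have the same integral over every measurable set. *)
Lemma integral_density (f : R -> R) (h : R -> \bar R) :
  measurable_fun setT f -> (forall x, 0 <= f x) ->
  (forall A : set R, measurable A ->
     distribution P X A = \int[mu]_(x in A) (f x)%:E)%E ->
  measurable_fun setT h ->
  (\int[P]_w h (X w) = \int[mu]_x (h x * (f x)%:E))%E.
Proof.
move=> mf f0 Pf.
have mX : measurable_fun setT (X : T -> measurableTypeR R) by exact: measurable_funP X.
pose mX_mixin := @isMeasurableFun.Build _ _ T (measurableTypeR R) X mX.
pose X' : {mfun T >-> measurableTypeR R} := HB.pack (X : T -> measurableTypeR R) mX_mixin.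
pose nu : {finite_measure set (measurableTypeR R) -> \bar R} := distribution P X'.
have numu : nu `<< mu.
  apply/null_content_dominatesP => A mA A0; rewrite [LHS]Pf// null_set_integral//.
  exact/measurable_EFinP/measurable_funTS.
have nuT : (\int[mu]_x (f x)%:E = 1)%E by rewrite -Pf// probability_setT.
have fi : mu.-integrable setT (EFin \o f).
  apply/integrableP; split; first exact/measurable_EFinP.
  under eq_integral do rewrite /= ger0_norm//.
  by rewrite nuT ltry.
have RNf : ae_eq mu setT (Radon_Nikodym_SigmaFinite.f nu mu) (EFin \o f).
  apply: integral_ae_eq => //.
  - exact: Radon_Nikodym_SigmaFinite.f_integrable.
  - exact/measurable_EFinP.
  - by move=> E _ mE; rewrite -Radon_Nikodym_SigmaFinite.f_integral//; exact: Pf.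
have ge0 (g : R -> \bar R) : measurable_fun setT g -> (forall x, 0 <= g x)%E ->
    (\int[P]_w g (X w) = \int[mu]_x (g x * (f x)%:E))%E.
  move=> mg g0.
  rewrite -[LHS](@ge0_integral_distribution _ _ _ _ _ P X' g)//.
  rewrite -(Radon_Nikodym_SigmaFinite.change_of_variables numu)//.
  apply: ae_eq_integral => //.
  - apply: emeasurable_funM => //.
    exact: measurable_int (Radon_Nikodym_SigmaFinite.f_integrable numu).
  - by apply: emeasurable_funM => //; exact/measurable_EFinP.
  - by apply: ae_eqe_mul2l.
move=> mh; rewrite integralE [RHS]integralE.
have fE x : (0 <= (f x)%:E)%E by rewrite lee_fin.
congr (_ - _)%E.
  rewrite (funepos_comp h X) ge0//; last exact: measurable_funepos.
  by apply: eq_integral => x _; rewrite !funeposE maxeMl// mul0e.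
rewrite (funeneg_comp h X) ge0//; last exact: measurable_funeneg.
by apply: eq_integral => x _; rewrite !funenegE maxeMl// mul0e mulNe.
Qed.

End transform.

End quantile_transform.

(** * The fundamental theorem of calculus on open intervals *)

Section improper_FTC.
Context {R : realType}.
Notation mu := (@lebesgue_measure R).
Implicit Types (a b : R) (G g : R -> R).

Lemma FTC2_cc G g a b : a < b ->
  (forall x, a <= x <= b -> is_derive x 1 G (g x)) ->
  (forall x, a <= x <= b -> {for x, continuous g}) ->
  (\int[mu]_(x in `[a, b]) (g x)%:E = (G b - G a)%:E)%E.
Proof.
move=> ab dG cg.
have cG x : a <= x <= b -> {for x, continuous G}.
  move=> /dG[dGx _]; apply: differentiable_continuous.
  exact/derivable1_diffP.
rewrite (@continuous_FTC2 _ g G)//.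
- apply: continuous_in_subspaceT => x; rewrite inE/= in_itv/=; exact: cg.
- split.
  + by move=> x; rewrite in_itv/= => /andP[ax xb]; have [] := dG x; rewrite ?(ltW ax) ?(ltW xb).
  + by apply: cvg_at_right_filter; apply: cG; rewrite lexx ltW.
  + by apply: cvg_at_left_filter; apply: cG; rewrite lexx ltW.
- move=> x; rewrite in_itv/= => /andP[ax xb]; rewrite derive1E.
  by have [] := dG x; rewrite ?(ltW ax) ?(ltW xb).
Qed.

(** Only the majorant [J] has to be integrable: the increments of [G] over the
    compact intervals [[al n, be n]] are bounded by integrals of [J], and these
    converge by dominated convergence. *)
Lemma improper_FTC_le (D : set R) G g J (al be : nat -> R) (l0 l1 : R) :
  measurable D -> (forall n, al n < be n) ->
  (forall n x, al n <= x <= be n -> D x) ->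
  (forall x, D x -> \forall n \near \oo, al n <= x <= be n) ->
  (forall x, D x -> is_derive x 1 G (g x)) ->
  (forall x, D x -> {for x, continuous g}) ->
  (forall x, D x -> g x <= J x) ->
  mu.-integrable D (EFin \o J) ->
  G (al n) @[n --> \oo] --> l0 -> G (be n) @[n --> \oo] --> l1 ->
  l1 - l0 <= \int[mu]_(x in D) J x.
Proof.
move=> mD albe subD cover dG cg gJ iJ Gl0 Gl1.
pose h n := (EFin \o J) \_ `[al n, be n].
have mJ : measurable_fun D (EFin \o J) by exact: measurable_int iJ.
have hE n : ((G (be n) - G (al n))%:E <= \int[mu]_(x in D) h n x)%E.
  have subDn : `[al n, be n] `<=` D by move=> x /=; rewrite in_itv/=; exact: subD.
  have <- : (\int[mu]_(x in `[al n, be n]) (g x)%:E = (G (be n) - G (al n))%:E)%E.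
    by apply: FTC2_cc => // x /subD; [exact: dG|exact: cg].
  rewrite -integral_mkcondr setIidr//; apply: le_integral => //.
  - apply: continuous_compact_integrable; first exact: segment_compact.
    by apply: continuous_in_subspaceT => x /set_mem/subDn; exact: cg.
  - exact: integrableS iJ.
  - by move=> x /set_mem/subDn Dx; rewrite lee_fin gJ.
have [] := @dominated_convergence _ _ _ mu D mD h (EFin \o J) (abse \o (EFin \o J)).
- move=> n; apply/(measurable_restrict _ _ _).1 => //.
  by apply: measurable_funS mJ => //; exact: subIsetl.
- exact: mJ.
- apply: aeW => x Dx; apply: cvg_near_cst; have := cover x Dx.
  by apply: filterS => n abx; rewrite /h patchE mem_set//= in_itv.
- exact: integrable_abse.
- apply: aeW => x n Dx; rewrite /h patchE; case: ifP => // _.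
  by rewrite abse0 abse_ge0.
move=> _ _ h2; rewrite -lee_fin /Rintegral fineK; last exact: integrable_fin_num.
have h1 : ((G (be n) - G (al n))%:E @[n --> \oo] --> (l1 - l0)%:E)%E.
  by apply: cvg_EFin; [exact: nearW|exact: cvgB].
by apply: lee_cvg_to h1 h2 _; exact: nearW.
Qed.

Lemma improper_FTC (D : set R) G g (al be : nat -> R) (l0 l1 : R) :
  measurable D -> (forall n, al n < be n) ->
  (forall n x, al n <= x <= be n -> D x) ->
  (forall x, D x -> \forall n \near \oo, al n <= x <= be n) ->
  (forall x, D x -> is_derive x 1 G (g x)) ->
  (forall x, D x -> {for x, continuous g}) ->
  mu.-integrable D (EFin \o g) ->
  G (al n) @[n --> \oo] --> l0 -> G (be n) @[n --> \oo] --> l1 ->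
  \int[mu]_(x in D) g x = l1 - l0.
Proof.
move=> mD albe subD cover dG cg ig Gl0 Gl1; apply/eqP; rewrite eq_le.
rewrite (improper_FTC_le mD albe subD cover dG cg _ ig Gl0 Gl1)// andbT.
have dGN x : D x -> is_derive x 1 (- G) (- g x) by move=> /dG dGx; exact: is_deriveN.
have cgN x : D x -> {for x, continuous (fun x => - g x)} by move=> /cg cgx; exact: cvgN.
have igN : mu.-integrable D (EFin \o (fun x => - g x)) by exact: integrableN ig.
have : - l1 - - l0 <= \int[mu]_(x in D) (- g x).
  by apply: (improper_FTC_le mD albe subD cover dGN cgN _ igN) => //; exact: cvgN.
rewrite -opprD lerNl; apply: le_trans; rewrite le_eqVlt; apply/orP; left; apply/eqP.
have -> : \int[mu]_(x in D) (- g x) = \int[mu]_(x in D) (-1 * g x).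
  by apply: eq_Rintegral => x _; rewrite mulN1r.
by rewrite RintegralZl// mulN1r opprK.
Qed.

(* An exhaustion of ]0, 1[ by compact intervals; dividing by 3 keeps
   [al n < be n] already for n = 0. *)
Let al n : R := n.+1%:R^-1 / 3.
Let be n : R := 1 - n.+1%:R^-1 / 3.

Let al_gt0 n : 0 < al n. Proof. by rewrite divr_gt0// invr_gt0. Qed.

Let al_le n : al n <= 1 / 3.
Proof. by rewrite ler_pM2r ?invr_gt0// invf_le1// ler1n. Qed.

Let al_cvg : al n @[n --> \oo] --> (0 : R).
Proof. by rewrite -[X in _ --> X](mul0r 3^-1); apply: cvgMl; exact: cvg_harmonic. Qed.

Let al_right : al n @[n --> \oo] --> (0 : R)^'+.
Proof.
move=> A hA; have : \forall n \near \oo, 0 < al n -> A (al n) by exact: (@al_cvg [set x | 0 < x -> A x] hA).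
by apply: filterS => n; apply.
Qed.

Let be_left : be n @[n --> \oo] --> (1 : R)^'-.
Proof.
have be_cvg : be n @[n --> \oo] --> (1 : R).
  by rewrite -[X in _ --> X]subr0; apply: cvgB; [exact: cvg_cst|exact: al_cvg].
move=> A hA; have : \forall n \near \oo, be n < 1 -> A (be n) by exact: (be_cvg [set x | x < 1 -> A x] hA).
by apply: filterS => n; apply; rewrite ltrBlDr ltrDl.
Qed.

Let exhaust01 : [/\ forall n, al n < be n,
  forall n x, al n <= x <= be n -> `](0:R), (1:R)[%classic x &
  forall x, `](0:R), (1:R)[%classic x -> \forall n \near \oo, al n <= x <= be n].
Proof.
split.
- by move=> n; have := al_le n; rewrite /be -/(al n); lra.
- move=> n x /andP[ax xb] /=; rewrite in_itv/=; have := al_gt0 n.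
  by move: xb; rewrite /be -/(al n); lra.
- move=> x /=; rewrite in_itv/= => /andP[x0 x1].
  have : \forall n \near \oo, al n < Num.min x (1 - x).
    by apply: (cvgr_lt _ al_cvg); rewrite lt_min x0 subr_gt0.
  apply: filterS => n; rewrite lt_min /be -/(al n); lra.
Qed.

Lemma FTC01_le G g (J : R -> R) (l0 l1 : R) :
  (forall x : R, 0 < x < 1 -> is_derive x 1 G (g x)) ->
  (forall x : R, 0 < x < 1 -> {for x, continuous g}) ->
  (forall x : R, 0 < x < 1 -> g x <= J x) ->
  mu.-integrable `](0:R), (1:R)[ (EFin \o J) ->
  G x @[x --> 0^'+] --> l0 -> G x @[x --> 1^'-] --> l1 ->
  l1 - l0 <= \int[mu]_(x in `]0%R, 1%R[) J x.
Proof.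
move=> dG cg gJ iJ G0 G1; have [ex1 ex2 ex3] := exhaust01.
by apply: (improper_FTC_le _ ex1 ex2 ex3 dG cg gJ iJ _ _) => //;
  [exact: cvg_comp al_right G0|exact: cvg_comp be_left G1].
Qed.

Lemma FTC01 G g (l0 l1 : R) :
  (forall x : R, 0 < x < 1 -> is_derive x 1 G (g x)) ->
  (forall x : R, 0 < x < 1 -> {for x, continuous g}) ->
  mu.-integrable `](0:R), (1:R)[ (EFin \o g) ->
  G x @[x --> 0^'+] --> l0 -> G x @[x --> 1^'-] --> l1 ->
  \int[mu]_(x in `]0%R, 1%R[) g x = l1 - l0.
Proof.
move=> dG cg ig G0 G1; have [ex1 ex2 ex3] := exhaust01.
by apply: (improper_FTC _ ex1 ex2 ex3 dG cg ig _ _) => //;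
  [exact: cvg_comp al_right G0|exact: cvg_comp be_left G1].
Qed.

End improper_FTC.

(** * Real-valued integrable functions *)

Section real_integrable.
Context d (T : measurableType d) (R : realType) (m : {measure set T -> \bar R}).
Variables (D : set T) (mD : measurable D).
Implicit Types f g : T -> R.

Lemma RintegrableZ (k : R) f : m.-integrable D (fun x => (f x)%:E) ->
  m.-integrable D (fun x => (k * f x)%:E).
Proof. by move=> fi; apply: eq_integrable (integrableZl mD k fi). Qed.

Lemma RintegrableD f g : m.-integrable D (fun x => (f x)%:E) ->
  m.-integrable D (fun x => (g x)%:E) ->
  m.-integrable D (fun x => (f x + g x)%:E).
Proof. by move=> fi gi; apply: eq_integrable (integrableD mD fi gi). Qed.

Lemma RintegrableB f g : m.-integrable D (fun x => (f x)%:E) ->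
  m.-integrable D (fun x => (g x)%:E) ->
  m.-integrable D (fun x => (f x - g x)%:E).
Proof. by move=> fi gi; apply: eq_integrable (integrableB mD fi gi). Qed.

Lemma Rintegrable_le f g : measurable_fun D f -> m.-integrable D (fun x => (g x)%:E) ->
  (forall x, D x -> `|f x| <= g x) -> m.-integrable D (fun x => (f x)%:E).
Proof.
move=> mf gi fg; apply: le_integrable gi => //; first exact/measurable_EFinP.
by move=> x Dx /=; rewrite lee_fin (le_trans (fg _ Dx))// ler_norm.
Qed.

End real_integrable.

(** * The standard normal law *)

Section standard_normal.
Context {R : realType}.
Notation mu := (@lebesgue_measure R).
Implicit Types x y z t : R.

Definition phi : R -> R := normal_pdf 0 1.

Let c0 : R := normal_peak 1.

Let c0_gt0 : 0 < c0.
Proof. by rewrite normal_peak_gt0// oner_neq0. Qed.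

Let c0_le1 : c0 <= 1.
Proof.
rewrite /c0 /normal_peak invf_le1 ?sqrtr_gt0; last first.
  by rewrite expr1n mul1r mulrn_wgt0// pi_gt0.
rewrite -[leLHS]sqrtr1 ler_sqrt// expr1n mul1r -mulr_natl; have := @pi_ge2 R; lra.
Qed.

Lemma phiE x : phi x = c0 * expR (- x ^+ 2 / 2).
Proof. by rewrite /phi normal_pdfE ?oner_neq0// /normal_fun subr0 expr1n. Qed.

Lemma phi_gt0 x : 0 < phi x.
Proof. by rewrite phiE mulr_gt0// expR_gt0. Qed.

Lemma phi_le1 x : phi x <= 1.
Proof. by rewrite (le_trans (normal_pdf_ub _ _ _))// oner_neq0. Qed.

Lemma continuous_phi : continuous phi.
Proof. by apply: continuous_normal_pdf; rewrite oner_neq0. Qed.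

Lemma measurable_phi : measurable_fun setT phi.
Proof. exact: measurable_normal_pdf. Qed.

Global Instance is_derive_phi x : is_derive x 1 phi (- x * phi x).
Proof.
have -> : phi = c0 \*: (expR \o (fun y => - 2^-1 *: (y ^+ 2))).
  apply/funext => y; rewrite phiE /GRing.scale/=; congr (_ * expR _); lra.
apply: is_derive_eq.
rewrite /= /GRing.scale/=.
move: (expR _) => e; lra.
Qed.

Lemma quartic_phi_le16 x : x ^+ 4 * phi x <= 16.
Proof.
rewrite phiE mulrCA.
have h : x ^+ 4 <= 16 * expR (x ^+ 2 / 2).
  have -> : x ^+ 2 / 2 = x ^+ 2 / 4 + x ^+ 2 / 4 by lra.
  rewrite expRD.
  have := expR_ge1Dx (x ^+ 2 / 4).
  have : 0 <= x ^+ 2 by exact: sqr_ge0.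
  have -> : x ^+ 4 = x ^+ 2 * x ^+ 2 by rewrite -exprD.
  move: (x ^+ 2) (expR _) => u v; nra.
rewrite mulNr expRN.
have e0 : 0 < expR (x ^+ 2 / 2) by exact: expR_gt0.
rewrite (@le_trans _ _ (x ^+ 4 / expR (x ^+ 2 / 2)))//.
  by rewrite ler_piMl// divr_ge0 ?exprn_even_ge0// ltW.
by rewrite ler_pdivrMr.
Qed.

Lemma normr_phi_le1 x : `|x * phi x| <= 1.
Proof.
rewrite normrM (gtr0_norm (phi_gt0 x)) phiE mulNr expRN.
have e0 : 0 < expR (x ^+ 2 / 2) by exact: expR_gt0.
rewrite mulrCA (@le_trans _ _ (`|x| / expR (x ^+ 2 / 2)))//.
  by rewrite ler_piMl// divr_ge0// ltW.
rewrite ler_pdivrMr// mul1r (le_trans _ (expR_ge1Dx _))//.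
rewrite -real_normK ?num_real//; have := sqr_ge0 (`|x| - 1); nra.
Qed.

(* The identity under the standard normal law: a random variable with cdf [Phi]. *)
Let PN : probability (measurableTypeR R) R := normal_prob 0 1.
Let N_mixin := @isMeasurableFun.Build _ _ (measurableTypeR R) R idfun
  (@measurable_id _ _ setT).
Let NRV : {RV PN >-> R} := HB.pack (idfun : measurableTypeR R -> R) N_mixin.

Lemma Phi_cdf x : cdf NRV x = (Phi x)%:E.
Proof. by rewrite /Phi fineK// fin_num_measure. Qed.

Lemma Phi_ge0 x : 0 <= Phi x.
Proof. by rewrite fine_ge0. Qed.

Lemma Phi_le1 x : Phi x <= 1.
Proof. by rewrite -lee_fin -Phi_cdf cdf_le1. Qed.

Lemma integrable_phi : mu.-integrable setT (EFin \o phi).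
Proof. exact: integrable_normal_pdf. Qed.

Global Instance is_derive_Phi x : is_derive x 1 Phi (phi x).
Proof.
have := @continuous_FTC1 _ phi (BInfty _ true) x (x + 1).
rewrite ltrDl ltr01 => /(_ isT) [].
- apply: integrableS integrable_phi => //.
- by rewrite ltNyr.
- exact: continuous_phi.
by move=> d1 d2; split => //; rewrite -derive1E d2.
Qed.

Lemma continuous_Phi : continuous (@Phi R).
Proof. by move=> x; apply: differentiable_continuous; exact/derivable1_diffP. Qed.

Lemma Phi_MVT x y : x < y -> exists2 c, x < c < y & Phi y - Phi x = phi c * (y - x).
Proof.
move=> xy; have [|c] := @MVT R Phi phi x y xy _.
  exact/continuous_subspaceT/continuous_Phi.
by rewrite in_itv/= => xcy ?; exists c.
Qed.

Lemma ltr_Phi : {mono (@Phi R) : x y / x < y}.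
Proof.
apply: leW_mono; apply: le_mono => x y xy; rewrite -subr_gt0.
have [c _ ->] := Phi_MVT xy.
by rewrite mulr_gt0 ?phi_gt0// subr_gt0.
Qed.

Lemma ler_Phi : {mono (@Phi R) : x y / x <= y}.
Proof. by move=> x y; rewrite !leNgt ltr_Phi. Qed.

Lemma Phi_cvgy : Phi x @[x --> +oo] --> (1 : R).
Proof. exact: (fine_cvg (cvg_cdfy1 NRV)). Qed.

Lemma Phi_cvgNy : Phi x @[x --> -oo] --> (0 : R).
Proof. exact: (fine_cvg (cvg_cdfNy0 NRV)). Qed.

Lemma Phi_gt0 x : 0 < Phi x.
Proof. by rewrite (le_lt_trans (Phi_ge0 (x - 1)))// ltr_Phi ltrBlDr ltrDl. Qed.

Lemma Phi_lt1 x : Phi x < 1.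
Proof. by rewrite (lt_le_trans _ (Phi_le1 (x + 1)))// ltr_Phi ltrDl. Qed.

Lemma Phi_surj z : 0 < z < 1 -> exists x, Phi x = z.
Proof.
move=> /andP[z0 z1].
have [a az] : exists a, Phi a < z.
  have : \forall x \near -oo, Phi x < z by exact: (cvgr_lt _ Phi_cvgNy).
  by move=> /filter_ex.
have [b zb] : exists b, z < Phi b.
  have : \forall x \near +oo, z < Phi x by exact: (cvgr_gt _ Phi_cvgy).
  by move=> /filter_ex.
have ab : a <= b by rewrite -ler_Phi ltW// (lt_trans az).
have [||c _ cz] := @IVT R Phi a b z ab; last by exists c.
- exact/continuous_subspaceT/continuous_Phi.
- by rewrite ge_min le_max !(ltW az) !(ltW zb) orbT.
Qed.

Lemma Phi_invK z : 0 < z < 1 -> Phi (Phi_inv z) = z.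
Proof.
by move=> /Phi_surj[x xz]; rewrite /Phi_inv pinvK// inE/=; exists x.
Qed.

Lemma PhiK : cancel (@Phi R) Phi_inv.
Proof.
move=> x; have := @Phi_invK (Phi x); rewrite Phi_gt0 Phi_lt1 => /(_ isT).
exact: (inc_inj ler_Phi).
Qed.

Lemma Phi_inv_le z x : 0 < z < 1 -> (Phi_inv z <= x) = (z <= Phi x).
Proof. by move=> z01; rewrite -ler_Phi Phi_invK. Qed.

Lemma Phi_inv_ge z x : 0 < z < 1 -> (x <= Phi_inv z) = (Phi x <= z).
Proof. by move=> z01; rewrite -ler_Phi Phi_invK. Qed.

Lemma is_derive_Phi_inv z : 0 < z < 1 -> is_derive z 1 Phi_inv (phi (Phi_inv z))^-1.
Proof.
move=> z01; rewrite -{1}(Phi_invK z01); apply: (@is_derive_inverse _ Phi).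
- by near=> x; exact: PhiK.
- by near=> x; exact: continuous_Phi.
- by rewrite gt_eqF// phi_gt0.
Unshelve. all: by end_near. Qed.

Lemma quantile_normal z : 0 < z < 1 -> quantile PN NRV z = Phi_inv z.
Proof.
move=> z01; apply: quantile_eq => //; first by rewrite Phi_cdf Phi_invK.
by move=> y yz; rewrite Phi_cdf lte_fin -(Phi_invK z01) ltr_Phi.
Qed.

Lemma measurable_Phi_inv : measurable_fun `](0:R), (1:R)[ (@Phi_inv R).
Proof.
apply: (@eq_measurable_fun _ _ _ _ _ (quantile PN NRV)); last exact: measurable_quantile.
by move=> z; rewrite inE/= in_itv/= => /quantile_normal.
Qed.

Lemma integral_Phi_inv (h : R -> \bar R) : measurable_fun setT h ->
  (\int[mu]_(z in `]0%R, 1%R[) h (Phi_inv z) = \int[mu]_x (h x * (phi x)%:E))%E.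
Proof.
move=> mh; rewrite -(@integral_density _ _ _ PN NRV phi)//.
- rewrite integral_quantile//; apply: eq_integral => z.
  by rewrite inE/= in_itv/= => /quantile_normal ->.
- exact: measurable_phi.
- by move=> x; exact/ltW/phi_gt0.
Qed.

Lemma integrable_Phi_inv (h : R -> R) : measurable_fun setT h ->
  mu.-integrable setT (fun x => (h x * phi x)%:E) ->
  mu.-integrable `](0:R), (1:R)[ (fun z => (h (Phi_inv z))%:E).
Proof.
move=> mh /integrableP[_ ih]; apply/integrableP; split.
  apply/measurable_EFinP.
  by apply: measurableT_comp => //; exact: measurable_Phi_inv.
rewrite (@integral_Phi_inv (fun x => `|(h x)%:E|%E)).
  apply: le_lt_trans ih; rewrite le_eqVlt; apply/orP; left; apply/eqP.
  apply: eq_integral => x _.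
  by rewrite -EFinM /= normrM (gtr0_norm (phi_gt0 x)).
by apply: measurableT_comp => //; exact/measurable_EFinP.
Qed.

Lemma Rintegral_Phi_inv (h : R -> R) : measurable_fun setT h ->
  \int[mu]_(z in `]0%R, 1%R[) h (Phi_inv z) = \int[mu]_x (h x * phi x).
Proof.
move=> mh; rewrite /Rintegral (@integral_Phi_inv (EFin \o h))//.
exact/measurable_EFinP.
Qed.

(* All moments needed here are finite because a degree 4 polynomial times [phi]
   is dominated by a multiple of the normal density of standard deviation 2. *)
Let quartic_phi_le x : (1 + x ^+ 4) * phi x <= 30 * c0 / normal_peak 2 * normal_pdf 0 2 x.
Proof.
have n2 : (2 : R) != 0 by rewrite pnatr_eq0.
rewrite phiE normal_pdfE// /normal_fun subr0.
rewrite [leRHS]mulrA divfK ?gt_eqF ?normal_peak_gt0// mulrCA [leRHS]mulrAC -mulrA.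
rewrite [leRHS]mulrA [leRHS]mulrC ler_pM2l//.
have -> : - x ^+ 2 / 2 = - x ^+ 2 / (2 ^+ 2 *+ 2) - 3 / 8 * x ^+ 2.
  by rewrite -mulr_natr; field.
rewrite expRB [leLHS]mulrCA [leRHS]mulrC ler_pM2l ?expR_gt0// ler_pdivrMr ?expR_gt0//.
have -> : 3 / 8 * x ^+ 2 = 3 / 16 * x ^+ 2 + 3 / 16 * x ^+ 2 by lra.
rewrite expRD.
have := expR_ge1Dx (3 / 16 * x ^+ 2).
have : 0 <= x ^+ 2 by exact: sqr_ge0.
have -> : x ^+ 4 = x ^+ 2 * x ^+ 2 by rewrite -exprD.
move: (x ^+ 2) (expR _) => u v; nra.
Qed.

Lemma integrable_quartic_phi : mu.-integrable setT (fun x => ((1 + x ^+ 4) * phi x)%:E).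
Proof.
have := integrableZl measurableT (30 * c0 / normal_peak 2) (@integrable_normal_pdf R 0 2).
apply: le_integrable => //.
- apply/measurable_EFinP/measurable_funM; last exact: measurable_phi.
  by apply: measurable_funD => //; exact: exprn_measurable.
- move=> x _; rewrite lee_fin ger0_norm; last first.
    by rewrite mulr_ge0 ?addr_ge0 ?exprn_even_ge0// ltW// phi_gt0.
  by rewrite (le_trans (quartic_phi_le x))// ler_norm.
Qed.

Lemma integrable_poly_phi (h : R -> R) : measurable_fun setT h ->
  (forall x, `|h x| <= 1 + x ^+ 4) ->
  mu.-integrable setT (fun x => (h x * phi x)%:E).
Proof.
move=> mh hle; apply: le_integrable integrable_quartic_phi => //.
- by apply/measurable_EFinP/measurable_funM => //; exact: measurable_phi.
- by move=> x _; rewrite lee_fin !normrM ler_wpM2r// (le_trans (hle x))// ler_norm.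
Qed.

Let abs_le_quartic x : `|x| <= 1 + x ^+ 4.
Proof.
have -> : x ^+ 4 = `|x| ^+ 4 by rewrite -normrX ger0_norm// exprn_even_ge0.
have : 0 <= `|x| by [].
move: `|x| => y y0; have -> : y ^+ 4 = (y ^+ 2) ^+ 2 by rewrite -exprM.
have := sqr_ge0 (y ^+ 2 - 1/2); have := sqr_ge0 (y - 1/2); nra.
Qed.

Let sqr_le_quartic x : `|x ^+ 2| <= 1 + x ^+ 4.
Proof.
rewrite ger0_norm ?sqr_ge0//; have -> : x ^+ 4 = (x ^+ 2) ^+ 2 by rewrite -exprM.
have := sqr_ge0 (x ^+ 2 - 1/2); nra.
Qed.

Let cvg_harm (f : nat -> R) : (forall n, `|f n| <= 16 / n.+1%:R) -> f n @[n --> \oo] --> (0 : R).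
Proof.
move=> fle; apply/norm_cvg0P.
apply: (@squeeze_cvgr _ _ _ _ (fun=> 0) (fun n => 16 * n.+1%:R^-1)).
- by apply: nearW => n; rewrite normr_ge0 fle.
- exact: cvg_cst.
- by rewrite -[X in _ --> X](mulr0 16); apply: cvgMr; exact: cvg_harmonic.
Qed.

Lemma phi_decay x : 1 <= `|x| ->
  `|x * phi x| <= 16 / `|x| /\ `|phi x| <= 16 / `|x|.
Proof.
move=> x1; have x0 : 0 < `|x| by exact: lt_le_trans x1.
rewrite !ler_pdivlMr// normrM (gtr0_norm (phi_gt0 x)); have := quartic_phi_le16 x.
have -> : x ^+ 4 = `|x| ^+ 4 by rewrite -normrX ger0_norm// exprn_even_ge0.
have := phi_gt0 x; move: `|x| (phi x) x1 => y p y1 p0.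
have y2 : y ^+ 2 <= y ^+ 4 by rewrite ler_weXn2l.
have y3 : y <= y ^+ 4 by rewrite ler_eXnr.
have y4 : y * p * y = y ^+ 2 * p by ring.
by rewrite y4; split; nra.
Qed.

Let al n : R := - n.+1%:R.
Let be n : R := n.+1%:R.

Let improper_FTC_R (G g : R -> R) :
  (forall x, is_derive x 1 G (g x)) -> continuous g ->
  mu.-integrable setT (EFin \o g) ->
  (forall x, 1 <= `|x| -> `|G x| <= 16 / `|x|) ->
  \int[mu]_x g x = 0.
Proof.
move=> dG cg ig Gle; rewrite (@improper_FTC _ _ G g al be 0 0) ?subr0//.
- move=> n; rewrite /al /be (@lt_trans _ _ 0)// oppr_lt0//.
- move=> x _; near=> n; rewrite /al /be -ler_norml.
  near: n; exists (Num.truncn `|x|) => // n /= xn.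
  by rewrite (le_trans (ltW (truncnS_gt _)))// ler_nat ltnS.
- by move=> x _; exact: cg.
- apply: cvg_harm => n; have := Gle (al n).
  by rewrite normrN normr_nat ler1n => ->.
- apply: cvg_harm => n; have := Gle (be n).
  by rewrite normr_nat ler1n => ->.
Unshelve. all: by end_near. Qed.

(** [x * phi x] is the derivative of [- phi], which vanishes at infinity. *)
Lemma integral_id_phi : \int[mu]_x (x * phi x) = 0.
Proof.
apply: (@improper_FTC_R (- phi)) => [x|||x x1].
- by apply: is_derive_eq; rewrite mulNr opprK.
- by move=> x; apply: cvgM => //; exact: continuous_phi.
- by apply: integrable_poly_phi => //; exact: abs_le_quartic.
- by rewrite normrN; have [] := phi_decay x1.
Qed.

(** [x ^+ 2 * phi x - phi x] is the derivative of [- (x * phi x)]. *)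
Lemma integral_sqr_phi : \int[mu]_x (x ^+ 2 * phi x) = 1.
Proof.
have i2 : mu.-integrable setT (fun x => (x ^+ 2 * phi x)%:E).
  exact: integrable_poly_phi.
have : \int[mu]_x (x ^+ 2 * phi x - phi x) = 0.
  apply: (@improper_FTC_R (- (id * phi))) => [x|||x x1].
  - apply: is_derive_eq; rewrite /GRing.scale/=; ring.
  - move=> x; apply: cvgB; last exact: continuous_phi.
    by apply: cvgM; [exact: exprn_continuous|exact: continuous_phi].
  - exact: (integrableB measurableT i2 integrable_phi).
  - by rewrite normrN; have [] := phi_decay x1.
rewrite RintegralB//; last exact: integrable_phi.
move=> /eqP; rewrite subr_eq0 => /eqP ->.
by rewrite /Rintegral integral_normal_pdf.
Qed.

Lemma integrable_Phi_inv1 : mu.-integrable `](0:R), (1:R)[ (fun z => (Phi_inv z)%:E).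
Proof. by apply: (@integrable_Phi_inv id) => //; exact: integrable_poly_phi. Qed.

Lemma integrable_Phi_inv2 : mu.-integrable `](0:R), (1:R)[ (fun z => (Phi_inv z ^+ 2)%:E).
Proof.
by apply: (@integrable_Phi_inv (fun x => x ^+ 2)) => //; exact: integrable_poly_phi.
Qed.

Lemma integrable_Phi_inv4 : mu.-integrable `](0:R), (1:R)[ (fun z => (Phi_inv z ^+ 4)%:E).
Proof.
apply: (@integrable_Phi_inv (fun x => x ^+ 4)) => //; apply: integrable_poly_phi => //.
by move=> x; rewrite ger0_norm ?exprn_even_ge0// lerDr.
Qed.

Lemma Rintegral_Phi_inv1 : \int[mu]_(z in `]0%R, 1%R[) Phi_inv z = 0.
Proof. by rewrite (@Rintegral_Phi_inv id)// integral_id_phi. Qed.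

Lemma Rintegral_Phi_inv2 : \int[mu]_(z in `]0%R, 1%R[) (Phi_inv z ^+ 2) = 1.
Proof.
by rewrite (@Rintegral_Phi_inv (fun x => x ^+ 2)) ?integral_sqr_phi.
Qed.

Lemma Phi_lip x y : `|Phi x - Phi y| <= `|x - y|.
Proof.
wlog xy : x y / x <= y => [H|].
  have [/H//|/ltW/H] := leP x y; by rewrite distrC (distrC x).
move: xy; rewrite le_eqVlt => /predU1P[->|xy]; first by rewrite !subrr.
rewrite distrC (distrC x); have [c _ ->] := Phi_MVT xy.
by rewrite normrM ler_piMl// gtr0_norm ?phi_gt0// phi_le1.
Qed.

Lemma phi_lip x y : `|phi x - phi y| <= `|x - y|.
Proof.
wlog xy : x y / x <= y => [H|].
  have [/H//|/ltW/H] := leP x y; by rewrite distrC (distrC x).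
move: xy; rewrite le_eqVlt => /predU1P[->|xy]; first by rewrite !subrr.
rewrite distrC (distrC x).
have [|c _ ->] := @MVT R phi (fun x => - x * phi x) x y xy _.
  exact/continuous_subspaceT/continuous_phi.
by rewrite normrM mulNr normrN ler_piMl// normr_phi_le1.
Qed.

(** The mean value theorem applied to [Phi], whose derivative is 1-Lipschitz. *)
Lemma Phi_Taylor x y : `|Phi x - Phi y - (x - y) * phi y| <= (x - y) ^+ 2.
Proof.
suff [c cy ->] : exists2 c, `|c - y| <= `|x - y| & Phi x - Phi y = phi c * (x - y).
  rewrite mulrC -mulrBr normrM -[leRHS]real_normK ?num_real// expr2.
  by rewrite ler_wpM2l// (le_trans (phi_lip c y)).
have [xy|yx|->] := ltgtP x y.
- have [c /andP[xc cy] h] := Phi_MVT xy; exists c.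
    by rewrite ler0_norm ?subr_le0 ?(ltW cy)// ler0_norm ?subr_le0 ?(ltW xy)// lerN2 lerD2r ltW.
  by rewrite -opprB h -mulrN opprB.
- have [c /andP[yc cx] h] := Phi_MVT yx; exists c => //.
  by rewrite ger0_norm ?subr_ge0 ?(ltW yc)// ger0_norm ?subr_ge0 ?(ltW yx)// lerD2r ltW.
- by exists y => //; rewrite !subrr mulr0.
Qed.

Let chebyshev_phi t (A : set R) : measurable A -> (forall x, A x -> t ^+ 2 <= x ^+ 2) ->
  t ^+ 2 * fine (\int[mu]_(x in A) (phi x)%:E) <= 1.
Proof.
move=> mA tA.
have iphi : mu.-integrable A (EFin \o phi) by exact: integrableS integrable_phi.
have i2 : mu.-integrable setT (fun x => (x ^+ 2 * phi x)%:E) by exact: integrable_poly_phi.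
have i2A : mu.-integrable A (fun x => (x ^+ 2 * phi x)%:E) by exact: integrableS i2.
rewrite -[fine _]/(\int[mu]_(x in A) phi x) -RintegralZl//.
rewrite -integral_sqr_phi.
apply: (@le_trans _ _ (\int[mu]_(x in A) (x ^+ 2 * phi x))).
  apply: le_Rintegral => //.
    exact: RintegrableZ.
  by move=> x Ax; rewrite ler_wpM2r ?tA// ltW// phi_gt0.
apply: fine_le; [exact: integrable_fin_num|exact: integrable_fin_num|].
apply: ge0_subset_integral => //.
- exact: measurable_int i2.
- by move=> x _; rewrite lee_fin mulr_ge0 ?sqr_ge0// ltW// phi_gt0.
Qed.

Lemma Phi_tail t : 0 <= t -> t ^+ 2 * (1 - Phi t) <= 1.
Proof.
move=> t0; have -> : 1 - Phi t = fine (\int[mu]_(x in `]t, +oo[) (phi x)%:E).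
  apply: EFin_inj; rewrite EFinB -Phi_cdf -ccdf_1_cdf.
  by rewrite -[RHS]/((fine (ccdf NRV t))%:E) fineK// fin_num_measure.
apply: chebyshev_phi => // x /=; rewrite in_itv/= andbT => /ltW tx.
by rewrite ler_sqr ?nnegrE// (le_trans t0).
Qed.

Lemma Phi_tailN t : t <= 0 -> t ^+ 2 * Phi t <= 1.
Proof.
move=> t0; apply: chebyshev_phi => // x /=; rewrite in_itv/= => xt.
by rewrite -sqrrN -(sqrrN x) ler_sqr ?nnegrE ?lerN2// oppr_ge0// (le_trans xt).
Qed.

End standard_normal.

(** * The mean of a probit-normal variable *)

Section mean_probit.
Context {R : realType}.
Notation mu := (@lebesgue_measure R).
Implicit Types m s c x u : R.

Lemma normal_pdf_phi m s u : 0 < s -> normal_pdf m s u = phi ((m - u) / s) / s.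
Proof.
move=> s0; rewrite /phi !normal_pdfE ?oner_neq0 ?gt_eqF//.
rewrite /normal_fun /normal_peak subr0 expr1n mul1r [RHS]mulrAC; congr (_ * expR _).
  rewrite -mulrnAr sqrtrM ?sqr_ge0// sqrtr_sqr gtr0_norm// invfM mulrC//.
by rewrite -mulr_natr; field; rewrite gt_eqF.
Qed.

Lemma normal_upper_tail m s c : 0 < s ->
  (\int[mu]_(u in `[c, +oo[) (normal_pdf m s u)%:E = (Phi ((m - c) / s))%:E)%E.
Proof.
move=> s0; pose F u : R := (m - u) / s.
have dF u : is_derive u 1 F (- s^-1).
  rewrite /F; apply: is_derive_eq; rewrite /GRing.scale/=; ring.
have dFE : F^`()%classic = cst (- s^-1).
  by apply/funext => u; rewrite derive1E; have [_ ->] := dF u.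
have cF : continuous F.
  by move=> u; apply: differentiable_continuous; apply/derivable1_diffP; have [] := dF u.
transitivity (\int[mu]_(x in `]-oo, F c]) (phi x)%:E)%E; last first.
  by rewrite /Phi fineK// (@fin_num_measure _ _ _ (normal_prob 0 1)).
rewrite (@decreasing_ge0_integration_by_substitutiony _ F phi c).
- apply: eq_integral => u _; rewrite dFE normal_pdf_phi//= opprK //.
- by move=> x y _ _ xy; rewrite /F ltr_pM2r ?invr_gt0// ltrD2l ltrN2.
- by move=> x _; rewrite dFE; exact: cst_continuous.
- by rewrite dFE; exact: is_cvg_cst.
- by rewrite dFE; exact: is_cvg_cst.
- split.
  + by move=> x _; have [] := dF x.
  + by apply: cvg_at_right_filter; exact: cF.
- rewrite /F; apply/cvgrNyPle => A; near=> u.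
  rewrite ler_pdivrMr// lerBlDr -lerBlDl.
  by near: u; apply: nbhs_pinfty_ge; rewrite num_real.
- exact/continuous_subspaceT/continuous_phi.
- by move=> x _; exact/ltW/phi_gt0.
Unshelve. all: by end_near. Qed.

Let measurable_joint s c : 0 < s -> measurable_fun [set: R * R]
  (fun xu : R * R => ((\1_(`[c, +oo[ : set R) xu.2) * normal_pdf xu.1 s xu.2 * phi xu.1)%:E).
Proof.
move=> s0; apply/measurable_EFinP; apply: measurable_funM; last first.
  exact: (measurableT_comp measurable_phi).
apply: measurable_funM.
  exact: (measurableT_comp (measurable_indic (measurable_itv `[c, +oo[))).
have -> : (fun xu : R * R => normal_pdf xu.1 s xu.2) =
    (fun xu => phi ((xu.1 - xu.2) / s) / s).
  by apply/funext => xu; rewrite normal_pdf_phi.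
apply: measurable_funM => //; apply: (measurableT_comp measurable_phi).
by apply: measurable_funM => //; exact: measurable_funB.
Qed.

Let complete_square (v w x u : R) : v != 0 -> w != 0 -> w = v + 1 ->
  - (x - u) ^+ 2 / (v * 2) + - x ^+ 2 / 2 =
  - u ^+ 2 / (w * 2) + - (x - u / w) ^+ 2 / (v / w * 2).
Proof.
move=> v0 w0 E.
have -> : v / w * 2 = (v * 2) / w by rewrite mulrAC.
rewrite invf_div.
apply: (@mulIf _ (v * 2)); first by rewrite mulf_neq0// pnatr_eq0.
apply: (@mulIf _ w) => //.
have -> : (- (x - u) ^+ 2 / (v * 2) + - x ^+ 2 / 2) * (v * 2) * w =
    (- (x - u) ^+ 2 - x ^+ 2 * v) * w by field; rewrite v0.
have -> : (- u ^+ 2 / (w * 2) + - (x - u / w) ^+ 2 * (w / (v * 2))) * (v * 2) * w =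
    - u ^+ 2 * v - (x * w - u) ^+ 2 by field; rewrite v0 w0.
rewrite E; ring.
Qed.

(* The joint density in [(u, x)] of [x + s N'] and [x], factored into the density
   of the sum and the conditional density of [x]. *)
Let pdf_product s s1 x u : 0 < s -> 0 < s1 -> s1 ^+ 2 = s ^+ 2 + 1 ->
  normal_pdf x s u * phi x = normal_pdf 0 s1 u * normal_pdf (u / s1 ^+ 2) (s / s1) x.
Proof.
move=> s0 s10 s1s.
rewrite /phi !normal_pdfE ?gt_eqF ?divr_gt0// /normal_fun /normal_peak.
rewrite [LHS]mulrACA [RHS]mulrACA -!expRD; congr (_ * expR _); last first.
  rewrite -!(mulr_natr (_ ^+ 2)) expr1n mul1r !subr0 exprMn exprVn.
  rewrite -complete_square ?expf_neq0 ?gt_eqF//; congr (_ / _ + _); congr (- _).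
  by rewrite -[LHS]sqrrN opprB.
rewrite -!invfM; congr (_^-1).
have peakE (r : R) : 0 < r -> Num.sqrt (r ^+ 2 * pi *+ 2) = r * Num.sqrt (pi *+ 2).
  by move=> r0; rewrite -mulrnAr sqrtrM ?sqr_ge0// sqrtr_sqr gtr0_norm.
rewrite !peakE// ?divr_gt0// mul1r.
by rewrite [RHS]mulrACA (mulrC s1) divfK ?gt_eqF// mulrA.
Qed.

(** Writing [Phi] as an upper tail of a normal density with mean [x] and
    exchanging the integrals, the integral over [x] becomes that of a conditional
    density, equal to 1; what remains is the upper tail of the sum of two
    independent normal variables. *)
Lemma mean_probit (s c : R) : 0 < s ->
  \int[mu]_x (Phi ((x - c) / s) * phi x) = Phi (- c / Num.sqrt (s ^+ 2 + 1)).
Proof.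
move=> s0; set s1 := Num.sqrt (s ^+ 2 + 1).
have s1s : s1 ^+ 2 = s ^+ 2 + 1 by rewrite sqr_sqrtr// addr_ge0// sqr_ge0.
have s10 : 0 < s1 by rewrite sqrtr_gt0 ltr_wpDl// sqr_ge0.
rewrite -[in RHS](add0r (- c)) /Rintegral -[RHS]/(fine (Phi ((0 - c) / s1))%:E) -normal_upper_tail//.
congr fine.
pose f (xu : R * R) := ((\1_(`[c, +oo[ : set R) xu.2) * normal_pdf xu.1 s xu.2 * phi xu.1)%:E.
have f0 xu : (0 <= f xu)%E.
  by rewrite lee_fin !mulr_ge0// ?normal_pdf_ge0// ltW// phi_gt0.
transitivity (\int[mu]_x \int[mu]_u f (x, u))%E.
  apply: eq_integral => x _; rewrite mulrC EFinM -normal_upper_tail//.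
  rewrite [X in (_ * X)%E]integral_mkcond -ge0_integralZl//; last 3 first.
  - apply/(measurable_restrictT _ _).1 => //; apply/measurable_EFinP/measurable_funTS.
    exact: measurable_normal_pdf.
  - by move=> u _; rewrite patchE; case: ifP => // _; rewrite lee_fin normal_pdf_ge0.
  - by rewrite lee_fin ltW// phi_gt0.
  apply: eq_integral => u _; rewrite patchE /f indicE.
  by case: ifP => _; rewrite ?mule0 ?mul0r// mul1r -EFinM mulrC.
transitivity (\int[mu]_u \int[mu]_x f (x, u))%E.
  apply: (@fubini_tonelli _ _ (measurableTypeR R) (measurableTypeR R) R mu mu f) => //.
  exact: measurable_joint.
rewrite [RHS]integral_mkcond; apply: eq_integral => u _.
transitivity (\int[mu]_x ((\1_(`[c, +oo[ : set R) u * normal_pdf 0 s1 u)%:E *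
    (normal_pdf (u / s1 ^+ 2) (s / s1) x)%:E))%E.
  by apply: eq_integral => x _; rewrite /f /= -EFinM -!mulrA (pdf_product _ _ s0 s10 s1s).
rewrite ge0_integralZl//; last 3 first.
- by apply/measurable_EFinP; exact: measurable_normal_pdf.
- by move=> x _; rewrite lee_fin normal_pdf_ge0.
- by rewrite lee_fin mulr_ge0// normal_pdf_ge0.
rewrite integral_normal_pdf mule1 patchE indicE.
by case: ifP => _; rewrite ?mul1r ?mul0r.
Qed.

End mean_probit.

(** * Averages over the unit interval *)

Section mean01.
Context {R : realType}.
Notation mu := (@lebesgue_measure R).
Implicit Types f g : R -> R.

Definition mean01 f : R := \int[mu]_(z in `]0%R, 1%R[) f z.

Definition int01 f : Prop := mu.-integrable `](0:R), (1:R)[ (fun z => (f z)%:E).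

Lemma int01D f g : int01 f -> int01 g -> int01 (fun z => f z + g z).
Proof. exact: RintegrableD. Qed.

Lemma int01B f g : int01 f -> int01 g -> int01 (fun z => f z - g z).
Proof. exact: RintegrableB. Qed.

Lemma int01Z k f : int01 f -> int01 (fun z => k * f z).
Proof. exact: RintegrableZ. Qed.

Lemma int01_le f g : measurable_fun `](0:R), (1:R)[ f -> int01 g ->
  (forall z, 0 < z < 1 -> `|f z| <= g z) -> int01 f.
Proof. by move=> mf gi fg; apply: Rintegrable_le gi _. Qed.

Let mu01 : mu `](0:R), (1:R)[ = 1%E.
Proof. by rewrite lebesgue_measure_itv/= lte01 oppr0 adde0. Qed.

Lemma int01_cst k : int01 (fun=> k).
Proof.
apply: (@measurable_bounded_integrable _ _ _ mu (fun=> k)) => //.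
- by rewrite [X in (X < _)%E]mu01 ltry.
- exact: bounded_cst.
Qed.

Lemma int01_bounded k f : measurable_fun `](0:R), (1:R)[ f ->
  (forall z, 0 < z < 1 -> `|f z| <= k) -> int01 f.
Proof. by move=> mf fk; apply: int01_le (int01_cst k) fk. Qed.

Lemma int01M f g :
  measurable_fun `](0:R), (1:R)[ f -> measurable_fun `](0:R), (1:R)[ g ->
  int01 (fun z => f z ^+ 2) -> int01 (fun z => g z ^+ 2) -> int01 (fun z => f z * g z).
Proof.
move=> mf mg fi gi; apply: int01_le (int01D fi gi) _; first exact: measurable_funM.
move=> z _; rewrite normrM -(real_normK (num_real (f z))) -(real_normK (num_real (g z))).
have := sqr_ge0 (`|f z| - `|g z|); have : 0 <= `|f z| by []; have : 0 <= `|g z| by [].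
move: `|f z| `|g z| => a b; nra.
Qed.

Lemma eq_mean01 f g : (forall z, 0 < z < 1 -> f z = g z) -> mean01 f = mean01 g.
Proof.
by move=> fg; apply: eq_Rintegral => z; rewrite inE/= in_itv/=; exact: fg.
Qed.

Lemma eq_int01 f g : (forall z, 0 < z < 1 -> f z = g z) -> int01 f -> int01 g.
Proof.
move=> fg; apply: eq_integrable => // z; rewrite inE/= in_itv/= => /fg ->//.
Qed.

Lemma mean01D f g : int01 f -> int01 g ->
  mean01 (fun z => f z + g z) = mean01 f + mean01 g.
Proof. by move=> *; exact: RintegralD. Qed.

Lemma mean01B f g : int01 f -> int01 g ->
  mean01 (fun z => f z - g z) = mean01 f - mean01 g.
Proof. by move=> *; exact: RintegralB. Qed.

Lemma mean01Z k f : int01 f -> mean01 (fun z => k * f z) = k * mean01 f.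
Proof. by move=> *; exact: RintegralZl. Qed.

Lemma mean01_cst k : mean01 (fun=> k) = k.
Proof.
by rewrite /mean01 Rintegral_cst// [X in fine X]mu01 mulr1.
Qed.

Lemma le_mean01 f g : int01 f -> int01 g -> (forall z, 0 < z < 1 -> f z <= g z) ->
  mean01 f <= mean01 g.
Proof. by move=> *; exact: le_Rintegral. Qed.

Lemma mean01_ge0 f : (forall z, 0 < z < 1 -> 0 <= f z) -> 0 <= mean01 f.
Proof. by move=> f0; apply: Rintegral_ge0 => z /=; rewrite in_itv/=; exact: f0. Qed.

Lemma EFin_mean01 f : int01 f -> (mean01 f)%:E = (\int[mu]_(z in `]0%R, 1%R[) (f z)%:E)%E.
Proof. by move=> fi; rewrite fineK//; exact: integrable_fin_num. Qed.

Lemma mean01_sqrB f g k : int01 (fun z => f z ^+ 2) -> int01 (fun z => f z * g z) ->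
  int01 (fun z => g z ^+ 2) ->
  int01 (fun z => (f z - k * g z) ^+ 2) /\
  mean01 (fun z => (f z - k * g z) ^+ 2) =
  mean01 (fun z => f z ^+ 2) - 2 * k * mean01 (fun z => f z * g z)
  + k ^+ 2 * mean01 (fun z => g z ^+ 2).
Proof.
move=> ff fg gg.
have E z : (f z - k * g z) ^+ 2 = (f z ^+ 2 - (2 * k) * (f z * g z)) + k ^+ 2 * (g z ^+ 2).
  by ring.
have i1 := int01B ff (int01Z (2 * k) fg).
have i2 := int01Z (k ^+ 2) gg.
split; first by apply: eq_int01 (int01D i1 i2) => z _; rewrite E.
rewrite (eq_mean01 (g := fun z => (f z ^+ 2 - (2 * k) * (f z * g z)) + k ^+ 2 * (g z ^+ 2)))//.
by rewrite mean01D// mean01B// ?mean01Z//; exact: int01Z.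
Qed.

(** Positivity on ]a, 1[ only, as a squared deviation may vanish at one point. *)
Lemma mean01_gt0 f (a : R) : 0 <= a < 1 -> int01 f ->
  (forall z, 0 < z < 1 -> 0 <= f z) ->
  (forall z, a < z < 1 -> 0 < f z) -> 0 < mean01 f.
Proof.
move=> /andP[a0 a1] fi f_ge0 f0; rewrite lt_def mean01_ge0// andbT.
apply/eqP => f00.
have mf : measurable_fun `](0:R), (1:R)[ (fun z => (f z)%:E) by exact: measurable_int fi.
have : (\int[mu]_(z in `]0%R, 1%R[) `|(f z)%:E| = 0)%E.
  transitivity (mean01 f)%:E; last by rewrite f00.
  rewrite EFin_mean01//; apply: eq_integral => z.
  by rewrite inE/= in_itv/= => /f_ge0 fz; rewrite ger0_norm.
move=> /(ae_eq_integral_abs _ _ _).1 => /(_ _ mf)[//|A [mA A0 /= sub]].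
pose D : set R := `]a, 1[%classic.
have : (mu D <= mu A)%E.
  apply: le_measure; [by apply/mem_set; exact: measurable_itv|exact/mem_set|].
  move=> z; rewrite /D/= in_itv/= => /andP[az z1]; apply: sub => /=.
  rewrite in_itv/= z1 (le_lt_trans a0 az) => /(_ isT) [] /eqP.
  by apply/negP; rewrite gt_eqF// f0// az.
rewrite A0 [X in (X <= _)%E]lebesgue_measure_itv/= lte_fin a1.
by rewrite -EFinD lee_fin leNgt subr_gt0 a1.
Qed.

Lemma mean01_itv (a b : R) : 0 <= a -> a <= b -> b <= 1 ->
  int01 (fun z => \1_(`]a, b[ : set R) z) /\
  mean01 (fun z => \1_(`]a, b[ : set R) z) = b - a.
Proof.
move=> a0 ab b1; split.
  apply: (@int01_bounded 1); first exact: measurable_indic.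
  by move=> z _; rewrite indicE; case: (_ \in _); rewrite ?normr1 ?normr0.
rewrite /mean01 /Rintegral integral_indic//.
rewrite (_ : _ `&` _ = `]a, b[%classic); last first.
  apply/setIidl => z /=; rewrite !in_itv/= => /andP[az zb].
  by rewrite (le_lt_trans a0 az) (lt_le_trans zb b1).
rewrite [X in fine X]lebesgue_measure_itv/= lte_fin.
by move: ab; rewrite le_eqVlt => /predU1P[->|->]; rewrite ?ltxx ?subrr.
Qed.

End mean01.

Section bounded_quantile.
Context {R : realType} d (T : measurableType d) (P : probability T R)
  (X : {RV P >-> R}).
Hypothesis X01 : forall z, 0 < z < 1 -> 0 < quantile P X z < 1.
Notation q := (quantile P X).
Notation mu := (@lebesgue_measure R).

Lemma int01_quantile : int01 q.
Proof.
apply: (@int01_bounded _ 1); first exact: measurable_quantile.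
by move=> z /X01/andP[q0 q1]; rewrite gtr0_norm// ltW.
Qed.

Lemma int01_quantile_sqrB c : int01 (fun z => (q z - c) ^+ 2).
Proof.
apply: (@int01_bounded _ ((1 + `|c|) ^+ 2)).
  by apply: measurable_funX; apply: measurable_funB => //; exact: measurable_quantile.
move=> z /X01/andP[q0 q1]; rewrite normrX lerXn2r ?nnegrE ?addr_ge0//.
by rewrite (le_trans (ler_normB _ _))// gtr0_norm// lerD2r ltW.
Qed.

Lemma expectation_mean01 : ('E_P[X] = (mean01 q)%:E)%E.
Proof.
rewrite EFin_mean01; last exact: int01_quantile.
by rewrite expectation_def (@integral_quantile _ _ _ _ _ EFin).
Qed.

Lemma variance_mean01 : ('V_P[X] = (mean01 (fun z => (q z - mean01 q) ^+ 2)%R)%:E)%E.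
Proof.
rewrite EFin_mean01; last exact: int01_quantile_sqrB.
rewrite /variance unlock expectation_mean01/= unlock/=.
rewrite -(@integral_quantile _ _ _ _ _ (fun x => ((x - mean01 q) ^+ 2)%:E))//.
by apply/measurable_EFinP/measurable_funX/measurable_funB.
Qed.

(** The parallel axis theorem. *)
Lemma mean01_sqrB_mean c :
  mean01 (fun z => (q z - c) ^+ 2) =
  mean01 (fun z => (q z - mean01 q) ^+ 2) + (mean01 q - c) ^+ 2.
Proof.
have E z : (q z - c) ^+ 2 = (q z - mean01 q) ^+ 2 +
    ((2 * (mean01 q - c)) * q z + (c ^+ 2 - mean01 q ^+ 2)) by ring.
rewrite (eq_mean01 (g := fun z => (q z - mean01 q) ^+ 2 +
    ((2 * (mean01 q - c)) * q z + (c ^+ 2 - mean01 q ^+ 2))))//.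
have i1 := int01Z (2 * (mean01 q - c)) int01_quantile.
rewrite mean01D; [|exact: int01_quantile_sqrB|by apply: int01D => //; exact: int01_cst].
rewrite mean01D//; last exact: int01_cst.
rewrite mean01Z ?mean01_cst; last exact: int01_quantile.
ring.
Qed.

Lemma mean01_mulB : int01 (fun z => q z * (1 - q z)) /\
  mean01 (fun z => q z * (1 - q z)) =
  mean01 q * (1 - mean01 q) - mean01 (fun z => (q z - mean01 q) ^+ 2).
Proof.
have i2 := int01_quantile_sqrB 0.
have E z : q z * (1 - q z) = q z - (q z - 0) ^+ 2 by ring.
split.
  by apply: eq_int01 (int01B int01_quantile i2) => z _; rewrite E.
rewrite (eq_mean01 (g := fun z => q z - (q z - 0) ^+ 2))//.
rewrite mean01B//; last exact: int01_quantile.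
by rewrite mean01_sqrB_mean; ring.
Qed.

End bounded_quantile.

(** * Probit-normal variables *)

Section probit_normal.
Context {R : realType} (rho delta : R) (rho0 : 0 < rho).
Context d (T : measurableType d) (P : probability T R) (Z : {RV P >-> R}).
Hypothesis Zcdf : forall y, 0 < y < 1 -> cdf Z y = (F_cdf rho delta y)%:E.
Notation q := (quantile P Z).
Notation p := (mean_p rho delta).
Notation mu := (@lebesgue_measure R).

Let Phi01 x : 0 < @Phi R x < 1.
Proof. by rewrite Phi_gt0 Phi_lt1. Qed.

Lemma quantile_probit z : 0 < z < 1 -> q z = Phi ((Phi_inv z - delta) / rho).
Proof.
move=> z01; set y0 := Phi _.
have y001 : 0 < y0 < 1 by exact: Phi01.
have lt0 y : 0 < y < y0 -> (cdf Z y < z%:E)%E.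
  move=> /andP[y0' yy0]; have y1 : 0 < y < 1.
    by rewrite y0' (lt_trans yy0)//; case/andP: y001.
  rewrite Zcdf// lte_fin /F_cdf -(Phi_invK z01) ltr_Phi -ltrBrDl.
  rewrite mulrC -ltr_pdivlMr//.
  by rewrite -ltr_Phi Phi_invK.
apply: quantile_eq => //.
  by rewrite Zcdf// /F_cdf /y0 PhiK mulrCA divff ?gt_eqF// mulr1 addrC subrK Phi_invK.
move=> y yy0; have [y0'|y0'] := ltP 0 y; first by rewrite lt0// y0'.
have [h0 _] := andP y001.
apply: (@le_lt_trans _ _ (cdf Z (y0 / 2))).
  by apply: cdf_nondecreasing; rewrite (le_trans y0')// divr_ge0// ltW.
by rewrite lt0// divr_gt0//= ltr_pdivrMr// ltr_pMr// ltr1n.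
Qed.

Lemma quantile_probit01 z : 0 < z < 1 -> 0 < q z < 1.
Proof. by move=> /quantile_probit ->. Qed.

Lemma mean_probit_quantile : mean01 q = p.
Proof.
rewrite (eq_mean01 quantile_probit) /mean01.
rewrite (@Rintegral_Phi_inv _ (fun x => Phi ((x - delta) / rho))) ?mean_probit//.
apply: continuous_measurable_fun => x.
apply: (@continuous_comp _ _ _ (fun x => (x - delta) / rho) Phi); last exact: continuous_Phi.
by apply: cvgM; [apply: cvgB; [exact: cvg_id|exact: cvg_cst]|exact: cvg_cst].
Qed.

Let v := fine 'V_P[Z].
Let M := p * (1 - p).

Lemma variance_probit : v = mean01 (fun z => (q z - p) ^+ 2).
Proof.
by rewrite /v (variance_mean01 quantile_probit01)/= mean_probit_quantile.
Qed.

Lemma variance_gap : M - v = mean01 (fun z => q z * (1 - q z)).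
Proof.
have [_ ->] := mean01_mulB quantile_probit01.
by rewrite mean_probit_quantile variance_probit.
Qed.

Lemma variance_lt : v < M.
Proof.
rewrite -subr_gt0 variance_gap.
have q0 z : 0 < z < 1 -> 0 < q z * (1 - q z).
  by move=> /quantile_probit01/andP[q0 q1]; rewrite mulr_gt0// subr_gt0.
apply: (@mean01_gt0 _ _ 0); rewrite ?lexx ?ltr01//.
  by have [] := mean01_mulB quantile_probit01.
by move=> z /q0/ltW.
Qed.

(** [q] is strictly increasing, so it exceeds [p] on the part of ]0, 1[ above
    [a], the value of the cdf at [p]. *)
Lemma variance_gt0 : 0 < v.
Proof.
have p01 : 0 < p < 1 by exact: Phi01.
have := Phi01 (delta + rho * Phi_inv p); set a := Phi _ => /andP[a0 a1].
rewrite variance_probit; apply: (@mean01_gt0 _ _ a); rewrite ?(ltW a0)//.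
- exact: (int01_quantile_sqrB quantile_probit01).
- by move=> z _; exact: sqr_ge0.
move=> z /andP[az z1]; have z01 : 0 < z < 1 by rewrite (lt_trans a0 az).
rewrite quantile_probit// exprn_even_gt0//= subr_eq0 gt_eqF//.
rewrite -{1}(Phi_invK p01) ltr_Phi ltr_pdivlMr// ltrBrDl [Phi_inv p * _]mulrC.
by rewrite -ltr_Phi Phi_invK.
Qed.

(** [Phi] is 1-Lipschitz, so [q] is within [Phi_inv z / rho] of a constant, and
    the second moment of [Phi_inv] is 1. *)
Lemma variance_le : v <= rho ^- 2.
Proof.
pose k : R := Phi (- delta / rho).
rewrite variance_probit -mean_probit_quantile.
have := mean01_sqrB_mean quantile_probit01 k.
have := sqr_ge0 (mean01 q - k).
suff : mean01 (fun z => (q z - k) ^+ 2) <= rho ^- 2 by lra.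
rewrite -[leRHS]mulr1 -Rintegral_Phi_inv2 -[\int[_]_(_ in _) _]/(mean01 _).
rewrite -mean01Z; last exact: integrable_Phi_inv2.
apply: le_mean01 => [||z z01].
- exact: (int01_quantile_sqrB quantile_probit01).
- apply: int01Z; exact: integrable_Phi_inv2.
- rewrite quantile_probit// /k -real_normK ?num_real//.
  rewrite [leRHS]mulrC -expr_div_n -[leRHS]real_normK ?num_real// ler_sqr ?nnegrE//.
  apply: (le_trans (Phi_lip _ _)).
  by rewrite -mulrBl opprK subrK.
Qed.

(** Outside the event that the normal variable lies within [rho * t] of [delta],
    whose probability is at most [2 * rho * t], the tail bounds on [Phi] give
    [q (1 - q) <= t ^- 2]. *)
Lemma variance_gap_le t : 0 < t -> M - v <= t ^- 2 + 2 * rho * t.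
Proof.
move=> t0; rewrite variance_gap.
set a := Phi (delta - rho * t); set b := Phi (delta + rho * t).
have rt : 0 < rho * t by rewrite mulr_gt0.
have ab : a <= b by rewrite ler_Phi; lra.
have [i1 m1] := @mean01_itv _ a b (Phi_ge0 _) ab (Phi_le1 _).
have -> : t ^- 2 + 2 * rho * t = mean01 (fun=> t ^- 2) + 2 * rho * t.
  by rewrite mean01_cst.
apply: (@le_trans _ _ (mean01 (fun=> t ^- 2) + mean01 (fun z => \1_(`]a, b[ : set R) z))).
  rewrite -mean01D//; last exact: int01_cst.
  apply: le_mean01 => [||z z01].
  - by have [] := mean01_mulB quantile_probit01.
  - by apply: int01D => //; exact: int01_cst.
  have /andP[q0 q1] := quantile_probit01 z01.
  rewrite indicE; have [zab|] := boolP (_ \in _).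
    have : 0 <= t ^- 2 by rewrite invr_ge0 exprn_ge0// ltW.
    rewrite /=; nra.
  rewrite notin_setE/= in_itv/= => /negP; rewrite negb_and -!leNgt addr0.
  set y := (Phi_inv z - delta) / rho.
  have qE : q z = Phi y by rewrite quantile_probit.
  rewrite qE in q0 q1 *.
  have t2 : 0 < t ^+ 2 by rewrite exprn_gt0.
  have -> : t ^- 2 = 1 * t ^- 2 by rewrite mul1r.
  rewrite ler_pdivlMr//.
  case/orP => h.
    have yt : y <= - t.
      by rewrite ler_pdivrMr// -Phi_inv_le// in h *; move: h; lra.
    have yt2 : t ^+ 2 <= y ^+ 2 by nra.
    have := @Phi_tailN _ y; rewrite (le_trans yt) ?oppr_le0 ?(ltW t0)// => /(_ isT).
    apply: le_trans; apply: (@le_trans _ _ (Phi y * t ^+ 2)).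
      by rewrite ler_wpM2r ?(ltW t2)// ler_piMr ?(ltW q0)// gerBl ltW.
    by rewrite mulrC ler_wpM2r// ltW.
  have yt : t <= y.
    by rewrite ler_pdivlMr// -Phi_inv_ge// in h *; move: h; lra.
  have yt2 : t ^+ 2 <= y ^+ 2 by nra.
  have := @Phi_tail _ y; rewrite (le_trans _ yt) ?(ltW t0)// => /(_ isT).
  apply: le_trans; apply: (@le_trans _ _ ((1 - Phi y) * t ^+ 2)).
    by rewrite ler_wpM2r ?(ltW t2)// ler_piMl ?subr_ge0 ?(ltW q1).
  by rewrite mulrC ler_wpM2r// subr_ge0 ltW.
rewrite lerD2l m1 -[b - a]ger0_norm ?subr_ge0// (le_trans (Phi_lip _ _))//.
by rewrite ger0_norm; lra.
Qed.

Let K4 : R := mean01 (fun z => Phi_inv z ^+ 4).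

(* If [c] is the inner product of a vector of length [s] with a unit vector [e],
   then [s e] is at most twice as far from the vector as any [l e], [l >= 0]. *)
Let sqr_dist_normalize (s l c : R) : 0 <= s -> 0 <= l -> c ^+ 2 <= s ^+ 2 ->
  2 * s ^+ 2 - 2 * s * c <= 4 * (s ^+ 2 - 2 * l * c + l ^+ 2).
Proof.
move=> s0 l0; rewrite -ler_sqrt ?sqr_ge0// !sqrtr_sqr (ger0_norm s0) ler_norml.
move=> /andP[sc cs]; have := sqr_ge0 (l - c).
have [c0|c0] := leP 0 c; nra.
Qed.

(** Taylor's formula at [- delta / rho] shows that [q] is at L2 distance of order
    [rho ^- 2] from an affine function of [Phi_inv]; replacing its constant by the
    mean [p] and its slope by the standard deviation at most doubles the distance. *)
Lemma probit_normal_approx :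
  mean01 (fun z => (q z - p - Num.sqrt v * Phi_inv z) ^+ 2) <=
  4 * mean01 (fun z => Phi_inv z ^+ 4) / rho ^+ 4.
Proof.
pose k : R := Phi (- delta / rho); pose l : R := phi (- delta / rho) / rho.
pose u z := q z - p.
set s := Num.sqrt v.
have v0 := variance_gt0.
have s2 : s ^+ 2 = v by rewrite sqr_sqrtr// ltW.
have mm := @measurable_Phi_inv R.
have mu' : measurable_fun `](0:R), (1:R)[ u.
  by apply: measurable_funB => //; exact: measurable_quantile.
have iu2 : int01 (fun z => u z ^+ 2) by exact: (int01_quantile_sqrB quantile_probit01).
have im2 : int01 (fun z : R => Phi_inv z ^+ 2) by exact: integrable_Phi_inv2.
have im4 : int01 (fun z : R => Phi_inv z ^+ 4) by exact: integrable_Phi_inv4.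
have im1 : int01 (fun z : R => Phi_inv z) by exact: integrable_Phi_inv1.
have ium : int01 (fun z => u z * Phi_inv z) by exact: int01M.
have iu : int01 u.
  by apply: int01B; [exact: (int01_quantile quantile_probit01)|exact: int01_cst].
have u0 : mean01 u = 0.
  rewrite mean01B ?mean01_cst ?mean_probit_quantile ?subrr//; last exact: int01_cst.
  exact: (int01_quantile quantile_probit01).
have m0 : mean01 (fun z : R => Phi_inv z) = 0 by exact: Rintegral_Phi_inv1.
have m2 : mean01 (fun z : R => Phi_inv z ^+ 2) = 1 by exact: Rintegral_Phi_inv2.
have [_ Es] := mean01_sqrB s iu2 ium im2.
have [il El] := mean01_sqrB l iu2 ium im2.
set c := mean01 (fun z => u z * Phi_inv z) in Es El.
have uv : mean01 (fun z => u z ^+ 2) = v by rewrite variance_probit.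
rewrite Es uv m2 -s2.
have cs : c ^+ 2 <= s ^+ 2.
  have [ic] := mean01_sqrB c iu2 ium im2; rewrite m2 uv -/c => Ec.
  have : 0 <= mean01 (fun z => (u z - c * Phi_inv z) ^+ 2).
    by apply: mean01_ge0 => z _; exact: sqr_ge0.
  rewrite Ec s2; lra.
have l0 : 0 <= l by rewrite divr_ge0// ltW// phi_gt0.
have := sqr_dist_normalize (sqrtr_ge0 v) l0 cs; rewrite -/s.
suff : mean01 (fun z => (u z - l * Phi_inv z) ^+ 2) <= K4 / rho ^+ 4.
  rewrite El uv m2 -s2 /K4; lra.
(* [D] is centred, so that adding the constant [p - k] increases its second
   moment. *)
pose D z := u z - l * Phi_inv z.
have iD : int01 D by apply: int01B => //; exact: int01Z.
have D0 : mean01 D = 0 by rewrite mean01B ?mean01Z ?u0 ?m0 ?mulr0 ?subr0//; exact: int01Z.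
have iD' := int01D (int01D il (int01Z (2 * (p - k)) iD)) (@int01_cst R ((p - k) ^+ 2)).
apply: (@le_trans _ _ (mean01 (fun z => (D z ^+ 2 + 2 * (p - k) * D z) + (p - k) ^+ 2))).
  rewrite mean01D ?mean01D ?mean01_cst ?mean01Z ?D0 ?mulr0 ?addr0//.
  - by rewrite lerDl sqr_ge0.
  - exact: int01Z.
  - by apply: int01D => //; exact: int01Z.
  - exact: int01_cst.
rewrite [K4 / _]mulrC /K4 -mean01Z//; apply: le_mean01 => // [|z z01].
  exact: int01Z.
have -> : D z ^+ 2 + 2 * (p - k) * D z + (p - k) ^+ 2 =
    (Phi ((Phi_inv z - delta) / rho) - k - (Phi_inv z / rho) * phi (- delta / rho)) ^+ 2.
  by rewrite /D /u quantile_probit// /l; ring.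
have := Phi_Taylor ((Phi_inv z - delta) / rho) (- delta / rho).
rewrite -mulrBl opprK subrK -/k => h.
rewrite -real_normK ?num_real// [leRHS]mulrC -expr_div_n.
have -> : (Phi_inv z / rho) ^+ 4 = ((Phi_inv z / rho) ^+ 2) ^+ 2 by rewrite -exprM.
by rewrite ler_sqr ?nnegrE ?sqr_ge0.
Qed.

End probit_normal.

(** * The beta law *)

Section beta_law.
Context {R : realType} (p n : R).
Hypotheses (p0 : 0 < p) (p1 : p < 1) (n0 : 0 < n).
Notation a := (p * n).
Notation b := ((1 - p) * n).
Context d (T : measurableType d) (P : probability T R) (X : {RV P >-> R}).
Hypothesis Xlaw : rbeta_distributed P X a b.
Notation mu := (@lebesgue_measure R).
Notation f := (rbeta_pdf a b).
Notation B := (rbeta_fun a b).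
Notation q := (quantile P X).

Let a0 : 0 < a. Proof. by rewrite mulr_gt0. Qed.
Let b0 : 0 < b. Proof. by rewrite mulr_gt0// subr_gt0. Qed.

Let ker_gt0 (x : R) : 0 < x < 1 -> 0 < rbeta_kernel a b x.
Proof. by move=> /andP[x0 x1]; rewrite mulr_gt0// powR_gt0// subr_gt0. Qed.

Let B_ge0 : 0 <= B.
Proof.
by apply: Rintegral_ge0 => x /=; rewrite in_itv/= => /ker_gt0/ltW.
Qed.

Let pdf_in (x : R) : 0 < x < 1 -> f x = rbeta_kernel a b x / B.
Proof. by move=> x01; rewrite /rbeta_pdf patchE mem_set//= in_itv. Qed.

Let pdf_out (x : R) : ~~ (0 < x < 1) -> f x = 0.
Proof. by move=> x01; rewrite /rbeta_pdf patchE memNset ?mul0r//= in_itv/=; exact/negP. Qed.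

Lemma rbeta_pdf_ge0 x : 0 <= f x.
Proof.
have [x01|x01] := boolP (0 < x < 1); last by rewrite pdf_out.
by rewrite pdf_in// divr_ge0// ltW// ker_gt0.
Qed.

Lemma measurable_rbeta_pdf : measurable_fun setT f.
Proof.
apply: measurable_funM => //; apply/(measurable_restrictT _ _).1 => //.
apply: measurable_funTS; apply: measurable_funM => //.
apply: (measurableT_comp (measurable_powR _)).
exact: measurable_funB.
Qed.

Let int_pdf : (\int[mu]_x (f x)%:E = 1)%E.
Proof. by rewrite -[LHS]Xlaw// probability_setT. Qed.

Lemma integrable_rbeta_pdf : mu.-integrable setT (EFin \o f).
Proof.
apply/integrableP; split.
  by apply/measurable_EFinP; exact: measurable_rbeta_pdf.
under eq_integral do rewrite /= ger0_norm ?rbeta_pdf_ge0//.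
by rewrite int_pdf ltry.
Qed.

(* A divergent normalizing integral would make [B], and the density, zero. *)
Let B_gt0 : 0 < B.
Proof.
rewrite lt_def B_ge0 andbT; apply/eqP => B0.
have : (\int[mu]_x (f x)%:E = 0)%E.
  by apply: integral0_eq => x _; rewrite /rbeta_pdf B0 invr0 mulr0.
by rewrite int_pdf => /eqP; rewrite eqe oner_eq0.
Qed.

Let pdf_gt0 (x : R) : 0 < x < 1 -> 0 < f x.
Proof. by move=> x01; rewrite pdf_in// divr_gt0// ker_gt0. Qed.

(** The integral of [(t - p) * f t] over [t] above [x], in closed form; its
    quotient by the density is the Stein kernel [x * (1 - x) / n] of the law. *)
Definition rbeta_stein (x : R) : R := x `^ a * (1 - x) `^ b / (B * n).
Notation H := rbeta_stein.

Let H_pdf (x : R) : 0 < x < 1 -> H x = f x * (x * (1 - x) / n).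
Proof.
move=> x01; have /andP[x0 x1] := x01; rewrite pdf_in// /H /rbeta_kernel.
rewrite -(mulr_powRB1 (ltW x0) a0) -(@mulr_powRB1 _ (1 - x) b) ?subr_ge0 ?(ltW x1)//.
by rewrite invfM; ring.
Qed.

Let is_derive_H (x : R) : 0 < x < 1 -> is_derive x 1 H ((p - x) * f x).
Proof.
move=> x01; have /andP[x0 x1] := x01.
have d1 : is_derive x 1 (@powR R ^~ a) (a * x `^ (a - 1)) by exact: is_derive1_powR.
have d2 : is_derive x 1 (fun y => (1 - y) `^ b) (- (b * (1 - x) `^ (b - 1))).
  have : is_derive (1 - x) 1 (@powR R ^~ b) (b * (1 - x) `^ (b - 1)).
    by apply: is_derive1_powR; rewrite subr_gt0.
  move=> d2; have d3 : is_derive x 1 (fun y : R => 1 - y) (-1).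
    rewrite (_ : (fun y : R => 1 - y) = cst 1 - id)//; apply: is_derive_eq. by rewrite sub0r.
  have := @is_derive1_comp _ (@powR R ^~ b) (fun y => 1 - y) x _ _ d2 d3.
  by move=> d4; apply: is_derive_eq; rewrite /GRing.scale/= mulrN1.
have -> : H = (B * n)^-1 \*: ((@powR R ^~ a) * (fun y => (1 - y) `^ b)).
  by apply/funext => y; rewrite /H mulrC.
apply: is_derive_eq; rewrite pdf_in// /rbeta_kernel /GRing.scale/=.
rewrite -(mulr_powRB1 (ltW x0) a0) -(@mulr_powRB1 _ (1 - x) b) ?subr_ge0 ?(ltW x1)//.
move: (x `^ _) ((1 - x) `^ _) => u w; field.
by rewrite !gt_eqF.
Qed.

(* The density is the quotient of [H], which is differentiable, by the Stein
   kernel. *)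
Let continuous_pdf (x : R) : 0 < x < 1 -> {for x, continuous f}.
Proof.
move=> x01; have /andP[x0 x1] := x01.
have cH : {for x, continuous H}.
  by apply: differentiable_continuous; apply/derivable1_diffP; have [] := is_derive_H x01.
have cw : {for x, continuous (fun y : R => y * (1 - y) / n)}.
  apply: cvgM; last exact: cvg_cst.
  by apply: cvgM => //; apply: cvgB => //; exact: cvg_cst.
have w0 : x * (1 - x) / n != 0.
  by rewrite gt_eqF// divr_gt0// mulr_gt0// subr_gt0.
have : {for x, continuous (fun y => H y / (y * (1 - y) / n))}.
  by apply: cvgM => //; exact: cvgV.
rewrite /prop_for /continuous_at H_pdf// mulfK//.
apply: cvg_trans; apply: near_eq_cvg.
have : \forall y \near x, y \in `](0:R), (1:R)[ by apply: near_in_itvoo; rewrite in_itv.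
apply: filterS => y; rewrite in_itv/= => y01; rewrite H_pdf// mulfK//.
by have /andP[y0 y1] := y01; rewrite gt_eqF// divr_gt0// mulr_gt0// subr_gt0.
Qed.

Let H_ge0 (x : R) : 0 <= x <= 1 -> 0 <= H x.
Proof.
move=> /andP[x0 x1]; rewrite /H divr_ge0// ?mulr_ge0 ?powR_ge0// ltW//.
Qed.

Let powR_le1 (c y : R) : 0 < c -> 0 <= y <= 1 -> y `^ c <= 1.
Proof.
move=> c0 /andP[y0 y1]; apply: (@le_trans _ _ (1 `^ c)); last by rewrite powR1.
by rewrite ge0_ler_powR ?nnegrE// ltW.
Qed.

Let near_right : \forall x \near (0:R)^'+, 0 < x < 1.
Proof.
near=> x; apply/andP; split; near: x; first exact: nbhs_right_gt.
exact: nbhs_right_lt.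
Unshelve. all: by end_near. Qed.

Let near_left : \forall x \near (1:R)^'-, 0 < x < 1.
Proof.
near=> x; apply/andP; split; near: x; last exact: nbhs_left_lt.
exact: nbhs_left_gt.
Unshelve. all: by end_near. Qed.

Let onem_left : (fun x : R => 1 - x) x @[x --> 1^'-] --> (0 : R)^'+.
Proof.
move=> A hA.
have c1 : (fun x : R => 1 - x) x @[x --> (1:R)] --> (0 : R).
  by rewrite -[X in _ --> X](subrr 1); apply: cvgB => //; exact: cvg_cst.
have : \forall x \near (1:R), 0 < 1 - x -> A (1 - x) := c1 [set x | 0 < x -> A x] hA.
by apply: filterS => x h x1; apply: h; rewrite subr_gt0.
Qed.

Let H_cvg0 : H x @[x --> 0^'+] --> (0 : R).
Proof.
apply: (@squeeze_cvgr _ _ _ _ (fun=> 0) (fun x => x `^ a * (B * n)^-1)).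
- near=> x; have x01 : 0 < x < 1 by near: x; exact: near_right.
  have /andP[x0 x1] := x01.
  rewrite H_ge0 ?(ltW x0) ?(ltW x1)//= /H ler_pM2r ?invr_gt0 ?mulr_gt0//.
  by rewrite ler_piMr ?powR_ge0// powR_le1// subr_ge0 ltW//= gerBl ltW.
- exact: cvg_cst.
- by rewrite -[X in _ --> X](mul0r (B * n)^-1); apply: cvgMl; exact: powR_cvg0.
Unshelve. all: by end_near. Qed.

Let H_cvg1 : H x @[x --> 1^'-] --> (0 : R).
Proof.
apply: (@squeeze_cvgr _ _ _ _ (fun=> 0) (fun x => (1 - x) `^ b * (B * n)^-1)).
- near=> x; have x01 : 0 < x < 1 by near: x; exact: near_left.
  have /andP[x0 x1] := x01.
  rewrite H_ge0 ?(ltW x0) ?(ltW x1)//= /H ler_pM2r ?invr_gt0 ?mulr_gt0//.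
  by rewrite ler_piMl ?powR_ge0// powR_le1// !ltW.
- exact: cvg_cst.
- rewrite -[X in _ --> X](mul0r (B * n)^-1); apply: cvgMl.
  exact: (@cvg_comp _ _ _ (fun x : R => 1 - x) (fun y => y `^ b) _ _ _ onem_left (powR_cvg0 b0)).
Unshelve. all: by end_near. Qed.

Lemma mean01_beta (h : R -> R) : measurable_fun setT h ->
  mean01 (fun z => h (q z)) = \int[mu]_(x in `]0%R, 1%R[) (h x * f x).
Proof.
move=> mh; rewrite /mean01 /Rintegral -(@integral_quantile _ _ _ _ _ (EFin \o h)); last first.
  exact/measurable_EFinP.
rewrite (@integral_density _ _ _ P X f)//; last 3 first.
- exact: measurable_rbeta_pdf.
- exact: rbeta_pdf_ge0.
- exact/measurable_EFinP.
rewrite [in RHS]integral_mkcond; congr fine; apply: eq_integral => x _.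
rewrite patchE; case: ifPn => // /negP; rewrite inE/= in_itv/= => /negP x01.
by rewrite (pdf_out x01) mule0.
Qed.

Lemma int01_beta (h : R -> R) : measurable_fun setT h ->
  int01 (fun z => h (q z)) -> mu.-integrable `](0:R), (1:R)[ (fun x => (h x * f x)%:E).
Proof.
move=> mh /integrableP[_ hi].
apply: (@integrableS _ _ _ _ setT) => //; apply/integrableP; split.
  apply/measurable_EFinP/measurable_funM => //; exact: measurable_rbeta_pdf.
apply: le_lt_trans hi; rewrite -(@integral_quantile _ _ _ _ _ (fun x => `|(h x)%:E|%E)); last first.
  by apply: measurableT_comp => //; exact/measurable_EFinP.
rewrite (@integral_density _ _ _ P X f (fun x => `|(h x)%:E|%E))//; last 3 first.
- exact: measurable_rbeta_pdf.
- exact: rbeta_pdf_ge0.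
- by apply: measurableT_comp => //; exact/measurable_EFinP.
rewrite le_eqVlt; apply/orP; left; apply/eqP; apply: eq_integral => x _.
by rewrite -EFinM /= normrM (ger0_norm (rbeta_pdf_ge0 x)).
Qed.

Definition rbeta_cdf (x : R) : R := parameterized_integral mu 0 x f.
Notation F := rbeta_cdf.

Let if01 : mu.-integrable `[0, 1] (EFin \o f).
Proof. by apply: integrableS integrable_rbeta_pdf. Qed.

Let FE (x : R) : (F x)%:E = (\int[mu]_(t in `[0%R, x]) (f t)%:E)%E.
Proof.
rewrite /F /parameterized_integral fineK//; apply: integrable_fin_num => //.
exact: integrableS integrable_rbeta_pdf.
Qed.

Lemma cdf_beta (x : R) : cdf X x = (F x)%:E.
Proof.
rewrite FE [LHS]Xlaw// integral_mkcond [RHS]integral_mkcond; apply: eq_integral => t _.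
rewrite !patchE; case: ifPn => [|/negP]; rewrite inE/= in_itv/=.
  move=> tx; case: ifPn => [//|/negP]; rewrite inE/= in_itv/= tx andbT => /negP t0.
  by rewrite pdf_out// negb_and -leNgt ltW// ltNge.
move=> /negP tx; rewrite ifF//; apply/negP; rewrite inE/= in_itv/= (negbTE tx).
by rewrite andbF.
Qed.

Let F0 : F 0 = 0.
Proof. by apply: EFin_inj; rewrite FE set_itv1 integral_set1. Qed.

Let F1 : F 1 = 1.
Proof.
apply: EFin_inj; rewrite FE -int_pdf integral_mkcond; apply: eq_integral => t _.
rewrite patchE; case: ifPn => // /negP; rewrite inE/= in_itv/= => /negP t01.
rewrite pdf_out//; apply: contra t01 => /andP[/ltW -> /ltW ->] //.
Qed.

Let is_derive_F (x : R) : 0 < x < 1 -> is_derive x 1 F (f x).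
Proof.
move=> x01; have /andP[x0 x1] := x01.
have [|d1 d2] := continuous_FTC1_closed x1 if01 x0; first exact: continuous_pdf.
by split => //; rewrite -derive1E d2.
Qed.

Let continuous_F : {within `[0, 1], continuous F}.
Proof. exact: parameterized_integral_continuous. Qed.

Let F_mono (x y : R) : 0 <= x -> y <= 1 -> x < y -> F x < F y.
Proof.
move=> x0 y1 xy; rewrite -subr_gt0.
have dF z : z \in `]x, y[ -> is_derive z 1 F (f z).
  rewrite in_itv/= => /andP[xz zy]; apply: is_derive_F.
  by rewrite (le_lt_trans x0 xz) (lt_le_trans zy y1).
have [|c] := MVT xy dF.
  apply: continuous_subspaceW continuous_F => t /=; rewrite !in_itv/= => /andP[xt ty].
  by rewrite (le_trans x0 xt) (le_trans ty y1).
rewrite in_itv/= => /andP[xc cy] ->; rewrite mulr_gt0 ?subr_gt0// pdf_gt0//.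
by rewrite (le_lt_trans x0 xc) (lt_le_trans cy y1).
Qed.

Let F01 (x : R) : 0 < x < 1 -> 0 < F x < 1.
Proof. by move=> /andP[x0 x1]; rewrite -{1}F0 -F1 !F_mono// ltW. Qed.

Let F_cvg0 : F x @[x --> 0^'+] --> (0 : R).
Proof.
by apply: cvg_at_right_filter; exact: (@parameterized_integral_cvg_left _ 0 1).
Qed.

Let F_cvg1 : F x @[x --> 1^'-] --> (1 : R).
Proof.
by rewrite -[X in _ --> X]F1; exact: (@parameterized_integral_cvg_at_left _ 0 1).
Qed.

Let quantile_ex (z : R) : 0 < z < 1 -> 0 < q z < 1 /\ F (q z) = z.
Proof.
move=> z01; have /andP[z0 z1] := z01.
have [|y] := IVT ler01 continuous_F (v := z).
  by rewrite ge_min le_max F0 F1 (ltW z0) (ltW z1) orbT.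
rewrite in_itv/= => /andP[y0 y1] Fy.
have y01 : 0 < y < 1.
  rewrite !lt_def y0 y1 !andbT; apply/andP; split; apply/eqP => yE.
    by move: z0; rewrite -Fy yE F0 ltxx.
  by move: z1; rewrite -Fy -yE F1 ltxx.
suff -> : q z = y by [].
apply: quantile_eq => //; first by rewrite cdf_beta Fy.
move=> t ty; have [t0|t0] := leP 0 t.
  by rewrite cdf_beta lte_fin -Fy F_mono.
apply: (@le_lt_trans _ _ (cdf X 0)); first exact/cdf_nondecreasing/ltW.
by rewrite cdf_beta F0 lte_fin.
Qed.

Lemma quantile_beta01 (z : R) : 0 < z < 1 -> 0 < q z < 1.
Proof. by move=> /quantile_ex[]. Qed.

Lemma cdf_quantile_beta (z : R) : 0 < z < 1 -> F (q z) = z.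
Proof. by move=> /quantile_ex[]. Qed.

(** [(p - x) * f x] is the derivative of [H], which vanishes at 0 and at 1. *)
Lemma mean_beta : mean01 q = p.
Proof.
have iq := int01_quantile quantile_beta01.
have i1 : int01 (fun z => p - q z) by apply: int01B => //; exact: int01_cst.
have : mean01 (fun z => p - q z) = 0.
  have mh : measurable_fun setT (fun x : R => p - x) by exact: measurable_funB.
  have cg (x : R) : 0 < x < 1 -> {for x, continuous (fun x : R => (p - x) * f x)}.
    move=> x01; apply: cvgM; last exact: continuous_pdf.
    by apply: cvgB => //; exact: cvg_cst.
  have ig := int01_beta mh i1.
  by rewrite (mean01_beta mh) (FTC01 is_derive_H cg ig H_cvg0 H_cvg1) subr0.
rewrite mean01B// ?mean01_cst; last exact: int01_cst.
by move=> /eqP; rewrite subr_eq0 => /eqP.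
Qed.

(** The derivative of [x * H x] integrates to 0 as well, and it expresses the
    second moment of [X] through its mean. *)
Lemma variance_beta :
  mean01 (fun z => (q z - p) ^+ 2) = p * (1 - p) / (n + 1).
Proof.
have iq := int01_quantile quantile_beta01.
have iq2 c := int01_quantile_sqrB quantile_beta01 c.
have [im Em] := mean01_mulB quantile_beta01.
rewrite mean_beta in Em.
pose h x : R := x * (1 - x) / n + x * (p - x).
have hE x : h x = (n^-1 + 1) * (x * (1 - x)) - (1 - p) * x.
  by rewrite /h; ring.
have mh : measurable_fun setT h.
  apply: measurable_funD; last by apply: measurable_funM => //; exact: measurable_funB.
  by do 2 apply: measurable_funM => //; exact: measurable_funB.
have i1 : int01 (fun z => (n^-1 + 1) * (q z * (1 - q z))) by exact: int01Z.
have i2 : int01 (fun z => (1 - p) * q z) by exact: int01Z.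
have ih : int01 (fun z => h (q z)).
  by apply: eq_int01 (int01B i1 i2) => z _; rewrite hE.
have : mean01 (fun z => h (q z)) = 0.
  have dG (x : R) : 0 < x < 1 -> is_derive x 1 (id * H) (h x * f x).
    move=> x01; have dH := is_derive_H x01; apply: is_derive_eq.
    rewrite /GRing.scale/= mulr1 H_pdf// /h; ring.
  have cg (x : R) : 0 < x < 1 -> {for x, continuous (fun x => h x * f x)}.
    move=> x01; apply: cvgM; last exact: continuous_pdf.
    by apply: cvgD; do ?[apply: cvgM|apply: cvgB|exact: cvg_cst|exact: cvg_id].
  have G0 : (id * H) x @[x --> 0^'+] --> (0 : R).
    rewrite -[X in _ --> X](mulr0 0); apply: cvgM => //.
    by apply: cvg_at_right_filter; exact: cvg_id.
  have G1 : (id * H) x @[x --> 1^'-] --> (0 : R).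
    rewrite -[X in _ --> X](mulr0 1); apply: cvgM => //.
    by apply: cvg_at_left_filter; exact: cvg_id.
  by rewrite (mean01_beta mh) (FTC01 dG cg (int01_beta mh ih) G0 G1) subr0.
rewrite (eq_mean01 (fun z _ => hE (q z))) mean01B// mean01Z// mean01Z// Em mean_beta.
set v := mean01 _ => h0.
have n1 : n + 1 != 0 by rewrite gt_eqF// addr_gt0.
apply: (mulIf n1); rewrite divfK//.
have : n * ((n^-1 + 1) * (p * (1 - p) - v) - (1 - p) * p) = 0 by rewrite h0 mulr0.
have -> : n * ((n^-1 + 1) * (p * (1 - p) - v) - (1 - p) * p) =
   (n * n^-1 + n) * (p * (1 - p) - v) - n * ((1 - p) * p) by ring.
rewrite mulfV ?gt_eqF//; lra.
Qed.

(** * Correlation of the beta law with the normal law *)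

(* The increasing map that carries [X] to a standard normal variable. *)
Let g (x : R) : R := Phi_inv (F x).

Let is_derive_g (x : R) : 0 < x < 1 -> is_derive x 1 g (f x / phi (g x)).
Proof.
move=> x01; have dF := is_derive_F x01; have dPhi := is_derive_Phi_inv (F01 x01).
have := @is_derive1_comp _ Phi_inv F x _ _ dPhi dF.
by move=> dg; apply: is_derive_eq; rewrite mulrC.
Qed.

Let continuous_g (x : R) : 0 < x < 1 -> {for x, continuous g}.
Proof.
move=> x01; apply: differentiable_continuous; apply/derivable1_diffP.
by have [] := is_derive_g x01.
Qed.

Let continuous_H (x : R) : 0 < x < 1 -> {for x, continuous H}.
Proof.
move=> x01; apply: differentiable_continuous; apply/derivable1_diffP.
by have [] := is_derive_H x01.
Qed.

Let nonneg_slope (G dG : R -> R) (x y : R) : 0 < x -> y < 1 -> x < y ->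
  (forall z : R, 0 < z < 1 -> is_derive z 1 G (dG z)) ->
  (forall z : R, 0 < z < 1 -> 0 <= dG z) -> G x <= G y.
Proof.
move=> x0 y1 xy dGG dG0; rewrite -subr_ge0.
have sub z : x <= z <= y -> 0 < z < 1.
  by move=> /andP[xz zy]; rewrite (lt_le_trans x0 xz) (le_lt_trans zy y1).
have dxy z : z \in `]x, y[ -> is_derive z 1 G (dG z).
  by rewrite in_itv/= => /andP[xz zy]; apply: dGG; apply: sub; rewrite !ltW.
have [|c] := MVT xy dxy.
  apply: continuous_in_subspaceT => z; rewrite inE/= in_itv/= => /sub z01.
  apply: differentiable_continuous; apply/derivable1_diffP.
  by have [] := dGG z z01.
rewrite in_itv/= => /andP[xc cy] ->; rewrite mulr_ge0 ?subr_ge0 ?(ltW xy)// dG0//.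
by apply: sub; rewrite !ltW.
Qed.

(* [F - H] and [1 - F - H] are monotone and vanish at 0 and at 1 respectively. *)
Let H_le_F (x : R) : 0 < x < 1 -> H x <= F x.
Proof.
move=> x01; have /andP[x0 x1] := x01; rewrite -subr_ge0.
have lim0 : (fun y => F y - H y) y @[y --> 0^'+] --> (0 : R).
  by rewrite -[X in _ --> X](subr0 0); exact: cvgB.
apply: (ler_cvg_to lim0 (cvg_cst (F x - H x))).
near=> y; have yx : y < x by near: y; exact: nbhs_right_lt.
have y0 : 0 < y by near: y; exact: nbhs_right_gt.
apply: (@nonneg_slope (F - H) (fun z => f z - (p - z) * f z)) => // z z01.
  have dF := is_derive_F z01; have dH := is_derive_H z01; exact: is_deriveB.
have -> : f z - (p - z) * f z = (1 - p + z) * f z by ring.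
have /andP[z0 _] := z01.
by rewrite mulr_ge0 ?rbeta_pdf_ge0// addr_ge0 ?subr_ge0 ?(ltW p1) ?(ltW z0).
Unshelve. all: by end_near. Qed.

Let H_le_FC (x : R) : 0 < x < 1 -> H x <= 1 - F x.
Proof.
move=> x01; have /andP[x0 x1] := x01; rewrite lerBrDr.
have lim1 : (fun y => H y + F y) y @[y --> 1^'-] --> (1 : R).
  by rewrite -[X in _ --> X](add0r 1); exact: cvgD.
apply: (ler_cvg_to (cvg_cst (H x + F x)) lim1).
near=> y; have yx : x < y by near: y; exact: nbhs_left_gt.
have y1 : y < 1 by near: y; exact: nbhs_left_lt.
apply: (@nonneg_slope (H + F) (fun z => (p - z) * f z + f z)) => // z z01.
  have dF := is_derive_F z01; have dH := is_derive_H z01; exact: is_deriveD.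
have -> : (p - z) * f z + f z = (p + (1 - z)) * f z by ring.
have /andP[_ z1] := z01.
by rewrite mulr_ge0 ?rbeta_pdf_ge0// addr_ge0 ?subr_ge0 ?(ltW z1) ?(ltW p0).
Unshelve. all: by end_near. Qed.

(* The sum of the boundary terms of the two integrations by parts of
   [(x - p) * g x * f x]: one integrates [g * f], a derivative of [- phi \o g],
   the other [(x - p) * f], a derivative of [- H]. *)
Let S (x : R) : R := - ((x - p) * phi (g x)) - g x * H x.

(* By the tail bounds on [Phi], [H <= min (F, 1 - F)] is small compared with
   [1 / g]. *)
Let S_small (x : R) : 0 < x < 1 -> 1 <= `|g x| -> `|S x| <= 17 / `|g x|.
Proof.
move=> x01 g1; have g0 : 0 < `|g x| by exact: lt_le_trans g1.
have /andP[x0 x1] := x01.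
have h1 : `|(x - p) * phi (g x)| <= 16 / `|g x|.
  have [_ h] := phi_decay g1; apply: le_trans h; rewrite normrM ler_piMl//.
  by rewrite ler_norml; apply/andP; split; have := p0; have := p1; lra.
have h2 : `|g x * H x| <= 1 / `|g x|.
  rewrite ler_pdivlMr// normrM mulrAC -expr2 real_normK ?num_real//.
  rewrite ger0_norm ?H_ge0 ?(ltW x0) ?(ltW x1)//.
  have PhigE : Phi (g x) = F x by rewrite /g Phi_invK// F01.
  have [gx|gx] := leP 0 (g x).
    apply: (le_trans _ (Phi_tail gx)); rewrite PhigE.
    by rewrite ler_wpM2l ?sqr_ge0// H_le_FC.
  apply: (le_trans _ (Phi_tailN (ltW gx))); rewrite PhigE.
  by rewrite ler_wpM2l ?sqr_ge0// H_le_F.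
rewrite /S -opprD normrN (le_trans (ler_normD _ _))//.
have -> : 17 / `|g x| = 16 / `|g x| + 1 / `|g x| by ring.
exact: lerD.
Qed.

Let S_cvg (FF : set_system R) : ProperFilter FF ->
  (\forall x \near FF, 0 < x < 1) ->
  (forall A, 0 < A -> \forall x \near FF, A <= `|g x|) ->
  S x @[x --> FF] --> (0 : R).
Proof.
move=> PF near01 gbig; apply/cvgr0Pnorm_le => e e0.
have A0 : 0 < Num.max 1 (17 / e) by rewrite lt_max ltr01.
near=> x.
have x01 : 0 < x < 1 by near: x.
have : Num.max 1 (17 / e) <= `|g x| by near: x; exact: gbig.
rewrite ge_max => /andP[g1 ge].
have g0 : 0 < `|g x| by exact: lt_le_trans g1.
by rewrite (le_trans (S_small x01 g1))// ler_pdivrMr// mulrC -ler_pdivrMr.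
Unshelve. all: by end_near. Qed.

Let S_cvg0 : S x @[x --> 0^'+] --> (0 : R).
Proof.
apply: S_cvg; first exact: near_right.
move=> A A0; have : \forall x \near 0^'+, F x < Phi (- A).
  exact: (cvgr_lt _ F_cvg0 _ (Phi_gt0 _)).
move=> FA; near=> x.
have x01 : 0 < x < 1 by near: x; exact: near_right.
rewrite ler0_norm /g; last first.
  rewrite Phi_inv_le ?F01//; apply: ltW; apply: (@lt_trans _ _ (Phi (- A))); first by near: x.
  by rewrite ltr_Phi oppr_lt0.
by rewrite lerNr Phi_inv_le ?F01// ltW//; near: x.
Unshelve. all: by end_near. Qed.

Let S_cvg1 : S x @[x --> 1^'-] --> (0 : R).
Proof.
apply: S_cvg; first exact: near_left.
move=> A A0; have : \forall x \near 1^'-, Phi A < F x.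
  exact: (cvgr_gt _ F_cvg1 _ (Phi_lt1 _)).
move=> FA; near=> x.
have x01 : 0 < x < 1 by near: x; exact: near_left.
rewrite ger0_norm /g; last first.
  rewrite Phi_inv_ge ?F01//; apply: ltW; apply: (@lt_trans _ _ (Phi A)); last by near: x.
  by rewrite ltr_Phi.
by rewrite Phi_inv_ge ?F01// ltW//; near: x.
Unshelve. all: by end_near. Qed.

Let dS (x : R) : R := 2 * ((x - p) * g x * f x) - (phi (g x) + f x / phi (g x) * H x).

Let is_derive_S (x : R) : 0 < x < 1 -> is_derive x 1 S (dS x).
Proof.
move=> x01; have dg := is_derive_g x01; have dH := is_derive_H x01.
have dphi := @is_derive1_comp _ phi g x _ _ (is_derive_phi (g x)) dg.
have -> : S = - ((id - cst p) * (phi \o g)) - g * H by [].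
apply: is_derive_eq; rewrite /GRing.scale/= /dS.
rewrite subr0 mulr1.
rewrite -[(id - cst p) x]/(x - p); move: (g x) (f x) (H x) => G0 f0 H0.
have := phi_gt0 G0; move: (phi G0) => P0 P00.
have E : f0 / P0 * P0 = f0 by rewrite divfK// gt_eqF.
have -> : (x - p) * (- G0 * P0 * (f0 / P0)) = - ((x - p) * G0) * (f0 / P0 * P0) by ring.
rewrite E; ring.
Qed.

Let M : R := p * (1 - p).
Let v : R := M / (n + 1).
Let s : R := Num.sqrt v.

Let M_gt0 : 0 < M. Proof. by rewrite mulr_gt0// subr_gt0. Qed.
Let v_gt0 : 0 < v. Proof. by rewrite divr_gt0// addr_gt0. Qed.
Let s_gt0 : 0 < s. Proof. by rewrite sqrtr_gt0. Qed.
Let s_sqr : s ^+ 2 = v. Proof. by rewrite sqr_sqrtr// ltW. Qed.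

(* A quadratic minorant of the square root of the Stein kernel, whose average only
   involves the variance of [X]: near [p] the kernel is about [M / n], and
   [|x - p|] is bounded by [s / 2 + (x - p) ^+ 2 / (2 * s)]. *)
Let k : R := (2 * s)^-1 + 1.
Let psi (x : R) : R := s * (1 - (s / 2 + k * (x - p) ^+ 2) / M).

Let psi_sqr_le (x : R) : 0 < x < 1 -> 0 < psi x -> psi x ^+ 2 <= x * (1 - x) / n.
Proof.
move=> /andP[x0 x1]; rewrite /psi pmulr_rgt0//.
set th := (_ / M) => th1; have {}th1 : th < 1 by rewrite -subr_gt0.
have k0 : 0 <= k by rewrite addr_ge0// invr_ge0 mulr_ge0// ltW.
have th0 : 0 <= th.
  apply: divr_ge0; last exact: ltW.
  by apply: addr_ge0; [rewrite divr_ge0 ?(ltW s_gt0)|rewrite mulr_ge0 ?sqr_ge0].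
have thM : th * M = s / 2 + k * (x - p) ^+ 2 by rewrite divfK// gt_eqF.
have yle : `|x - p| <= s / 2 + (2 * s)^-1 * (x - p) ^+ 2.
  have s2 : 0 < 2 * s by rewrite mulr_gt0.
  rewrite -(ler_pM2l s2) mulrDr [X in _ <= _ + X]mulrA mulfV ?gt_eqF// mul1r.
  rewrite -(real_normK (num_real (x - p))).
  have := sqr_ge0 (`|x - p| - s); lra.
have u_ge : M * (1 - th) <= x * (1 - x).
  have -> : M * (1 - th) = M - th * M by ring.
  rewrite thM /k; move: yle; rewrite ler_norml => /andP[y1 y2].
  set e := s / 2 + (2 * s)^-1 * (x - p) ^+ 2 in y1 y2.
  have e0 : 0 <= e by lra.
  have h : - e <= (x - p) * (1 - 2 * p).
    by have := p0; have := p1; have [?|?] := leP 0 (1 - 2 * p); nra.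
  have -> : M - (s / 2 + ((2 * s)^-1 + 1) * (x - p) ^+ 2) =
    M - e - (x - p) ^+ 2 by rewrite /e; ring.
  rewrite /M; lra.
have n1 : 0 < n + 1 by rewrite addr_gt0.
have u0 : 0 < x * (1 - x) by rewrite mulr_gt0// subr_gt0.
rewrite exprMn s_sqr; apply: (@le_trans _ _ (x * (1 - x) / (n + 1))).
  rewrite /v mulrAC ler_pM2r ?invr_gt0//; apply: le_trans u_ge.
  by rewrite ler_pM2l// expr2 ler_piMr ?subr_ge0 ?(ltW th1)// gerBl.
by rewrite ler_pM2l// lef_pV2 ?posrE// lerDl.
Qed.

(* The arithmetic-geometric mean inequality for [phi (g x)] and [g' x * H x]. *)
Let AMGM (P0 f0 w c : R) : 0 < P0 -> 0 <= f0 -> 0 <= w -> (0 < c -> c ^+ 2 <= w) ->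
  2 * c * f0 <= P0 + f0 / P0 * (f0 * w).
Proof.
move=> P00 f00 w0 cw; have [c0|c0] := leP c 0.
  apply: (@le_trans _ _ 0); first by nra.
  by rewrite addr_ge0 ?(ltW P00)// !mulr_ge0// invr_ge0 ltW.
have {}cw := cw c0.
have r0 : 0 <= f0 / P0 * f0 by rewrite !mulr_ge0// invr_ge0 ltW.
apply: (@le_trans _ _ (P0 + f0 / P0 * f0 * c ^+ 2)); last first.
  by rewrite lerD2l mulrA ler_wpM2l.
rewrite -(ler_pM2l P00).
have -> : P0 * (P0 + f0 / P0 * f0 * c ^+ 2) = P0 ^+ 2 + (P0 / P0) * (f0 * c) ^+ 2 by ring.
rewrite divff ?gt_eqF// mul1r; have := sqr_ge0 (P0 - f0 * c); nra.
Qed.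

Let dS_le (x : R) : 0 < x < 1 -> dS x <= 2 * ((x - p) * g x - psi x) * f x.
Proof.
move=> x01; have /andP[x0 x1] := x01; rewrite /dS H_pdf//.
have w0 : 0 <= x * (1 - x) / n by rewrite ltW// divr_gt0// mulr_gt0// subr_gt0.
have := AMGM (phi_gt0 (g x)) (rbeta_pdf_ge0 x) w0 (psi_sqr_le x01).
lra.
Qed.

Let continuous_dS (x : R) : 0 < x < 1 -> {for x, continuous dS}.
Proof.
move=> x01.
have cphi : {for x, continuous (fun y => phi (g y))}.
  by apply: continuous_comp; [exact: continuous_g|exact: continuous_phi].
have cf := continuous_pdf x01; have cg := continuous_g x01; have cH := continuous_H x01.
apply: cvgB.
  apply: cvgM; first exact: cvg_cst.
  by apply: cvgM => //; apply: cvgM => //; apply: cvgB => //; exact: cvg_cst.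
apply: cvgD => //; apply: cvgM => //; apply: cvgM => //.
by apply: cvgV => //; rewrite gt_eqF// phi_gt0.
Qed.

Let iq2 : int01 (fun z => (q z - p) ^+ 2).
Proof. exact: (int01_quantile_sqrB quantile_beta01). Qed.

Let mq : measurable_fun `](0:R), (1:R)[ q.
Proof. exact: measurable_quantile. Qed.

Let int01_corr : int01 (fun z => (q z - p) * Phi_inv z).
Proof.
apply: int01M => //; last exact: integrable_Phi_inv2.
- exact: measurable_funB.
- exact: measurable_Phi_inv.
Qed.

Let psi_mean : int01 (fun z => psi (q z)) /\
  mean01 (fun z => psi (q z)) = s * (1 - (s + v) / M).
Proof.
have psiE x : psi x = s * (1 - s / 2 / M) - s * k / M * (x - p) ^+ 2.
  by rewrite /psi; ring.
have i1 := int01_cst (s * (1 - s / 2 / M)).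
have i2 := int01Z (s * k / M) iq2.
split; first by apply: eq_int01 (int01B i1 i2) => z _; rewrite psiE.
rewrite (eq_mean01 (fun z _ => psiE (q z))) mean01B// mean01_cst mean01Z//.
rewrite variance_beta -/M -/v /k.
have -> : s * (1 - s / 2 / M) - s * ((2 * s)^-1 + 1) / M * v =
  s * (1 - (s / 2 + (2 * s)^-1 * v + v) / M) by ring.
rewrite -[in (2 * s)^-1 * v]s_sqr; have -> : (2 * s)^-1 * s ^+ 2 = s / 2.
  by field; rewrite gt_eqF.
by congr (_ * (1 - _ / _)); lra.
Qed.

(* The integrand [(x - p) * g x * f x] of the correlation is integrable, but the
   two functions produced by integration by parts are not known to be; the
   one-sided version of the fundamental theorem of calculus suffices. *)
Let corr_ge : s * (1 - (s + v) / M) <= mean01 (fun z => (q z - p) * Phi_inv z).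
Proof.
(* [Phi_inv] is measurable on ]0, 1[ only. *)
pose gm (x : R) : R := (Phi_inv \_ `](0:R), (1:R)[) (F x).
have gmE (x : R) : 0 < x < 1 -> gm x = g x.
  by move=> /F01 Fx; rewrite /gm patchE mem_set//= in_itv.
have mF : measurable_fun setT F.
  have -> : F = fine \o cdf X by apply/funext => x; rewrite /= cdf_beta.
  by apply: measurableT_comp => //; exact: cdf_measurable.
have mgm : measurable_fun setT gm.
  apply: (measurableT_comp _ mF); apply/(measurable_restrictT _ _).1 => //.
  exact: measurable_Phi_inv.
have mpsi : measurable_fun setT psi.
  apply: measurable_funM => //; apply: measurable_funB => //; apply: measurable_funM => //.
  apply: measurable_funD => //; apply: measurable_funM => //.
  by apply: measurable_funX; exact: measurable_funB.
pose h (x : R) : R := 2 * ((x - p) * gm x - psi x).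
have mh : measurable_fun setT h.
  apply: measurable_funM => //; apply: measurable_funB => //.
  by apply: measurable_funM => //; exact: measurable_funB.
have [ipsi Epsi] := psi_mean.
have hE z : 0 < z < 1 -> 2 * ((q z - p) * Phi_inv z - psi (q z)) = h (q z).
  by move=> z01; rewrite /h gmE ?quantile_beta01// /g cdf_quantile_beta.
have ih : int01 (fun z => h (q z)).
  by apply: eq_int01 hE _; apply: int01Z; exact: int01B.
have dSh (x : R) : 0 < x < 1 -> dS x <= h x * f x.
  by move=> x01; rewrite /h gmE// dS_le.
have := FTC01_le is_derive_S continuous_dS dSh (int01_beta mh ih) S_cvg0 S_cvg1.
rewrite -mean01_beta// -(eq_mean01 hE) mean01Z; last exact: int01B.
rewrite mean01B// Epsi; lra.
Qed.

(** Quantitative central limit theorem for the beta law in W2 distance: the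
    squared distance is smaller than the variance [v] by a factor of order
    [(s + v) / M]. *)
Lemma beta_normal_approx :
  mean01 (fun z => (q z - p - s * Phi_inv z) ^+ 2) <= 2 * v * (s + v) / M.
Proof.
have [_ ->] := mean01_sqrB s iq2 int01_corr (@integrable_Phi_inv2 R).
rewrite variance_beta -/M -/v.
rewrite [mean01 (fun z => Phi_inv z ^+ 2)]Rintegral_Phi_inv2 mulr1 s_sqr.
have := corr_ge; rewrite -(ler_pM2l s_gt0) mulrA -expr2 s_sqr.
set c := mean01 _; have -> : 2 * v * (s + v) / M = 2 * v * ((s + v) / M) by ring.
lra.
Qed.

End beta_law.

(** * Wasserstein bounds for a matched pair *)

Section bernoulli_approx.
Context {R : realType} d (T : measurableType d) (P : probability T R)
  (X : {RV P >-> R}).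
Hypothesis X01 : forall z, 0 < z < 1 -> 0 < quantile P X z < 1.
Notation q := (quantile P X).
Notation p := (mean01 q).

Definition bernoulli_quantile (r : R) (z : R) : R := \1_(`](1 - r), 1[ : set R) z.

(** The difference [u] between [q] and the Bernoulli quantile has mean 0.  With
    [c] the value of [q] at the jump [1 - p], monotonicity of [q] gives
    [q (1 - q) >= (1 - c) u] where [u >= 0] and [q (1 - q) >= - c u] where
    [u <= 0], that is, [2 q (1 - q) >= |u| + (1 - 2 c) u]; the last term has
    mean 0. *)
Lemma mean01_quantile_bernoulli : 0 < p < 1 ->
  int01 (fun z => `|q z - bernoulli_quantile p z|) /\
  mean01 (fun z => `|q z - bernoulli_quantile p z|) <=
  2 * mean01 (fun z => q z * (1 - q z)).
Proof.
move=> /andP[p0 p1].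
have p01 : 0 <= 1 - p by rewrite subr_ge0 ltW.
have p01' : 1 - p <= 1 by rewrite gerBl ltW.
have [iJ mJ] := mean01_itv p01 p01' (lexx 1).
have iq := int01_quantile X01.
have [iqq _] := mean01_mulB X01.
pose u z := q z - bernoulli_quantile p z.
have iu : int01 u by exact: int01B.
have iau : int01 (fun z => `|u z|) by exact: integrable_norm iu.
have mu0 : mean01 u = 0.
  by rewrite mean01B// [X in _ - X]mJ; ring.
split=> //.
set c := q (1 - p).
have c01 : 0 < 1 - p < 1 by rewrite subr_gt0 p1 gtrBl.
have pw z : 0 < z < 1 -> `|u z| + (1 - 2 * c) * u z <= 2 * (q z * (1 - q z)).
  move=> z01; have /andP[q0 q1] := X01 z01; have /andP[c0 c1] := X01 c01.
  have /andP[z0 z1] := z01.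
  rewrite /u /bernoulli_quantile indicE; have [|] := boolP (z \in _).
    rewrite inE/= in_itv/= => /andP[pz _].
    have cq : c <= q z.
      by apply: quantile_nondecreasing; rewrite ?in_itv//= ltW.
    by rewrite ler0_norm ?subr_le0 ?(ltW q1)// /=; nra.
  rewrite notin_setE/= in_itv/= z1 andbT => /negP; rewrite -leNgt => zp.
  have cq : q z <= c.
    by apply: quantile_nondecreasing; rewrite ?in_itv.
  by rewrite /= subr0 gtr0_norm//; nra.
have := le_mean01 (int01D iau (int01Z (1 - 2 * c) iu)) (int01Z 2 iqq) pw.
rewrite mean01D//; last exact: int01Z.
by rewrite mean01Z// mu0 mulr0 addr0 mean01Z.
Qed.

End bernoulli_approx.

Section W2_bounds.
Context {R : realType}.

Lemma dist01_le1 (x y : R) : 0 < x < 1 -> 0 < y < 1 -> `|x - y| <= 1.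
Proof.
by move=> /andP[x0 x1] /andP[y0 y1]; rewrite ler_norml; apply/andP; split; lra.
Qed.

Lemma W2_le d1 (T1 : measurableType d1) (P : probability T1 R) (X : {mfun T1 >-> R})
  d2 (T2 : measurableType d2) (Q : probability T2 R) (Y : {mfun T2 >-> R}) (b : R) :
  int01 (fun z => (quantile P X z - quantile Q Y z) ^+ 2) ->
  mean01 (fun z => (quantile P X z - quantile Q Y z) ^+ 2) <= b ->
  (W2 P X Q Y <= (Num.sqrt b)%:E)%E.
Proof.
move=> i le_b; rewrite /W2 -[X in sqrte X]/(_) -(EFin_mean01 i) /=.
by rewrite lee_fin ler_wsqrtr.
Qed.

Lemma W2_ge0 d1 (T1 : measurableType d1) (P : probability T1 R) (X : {mfun T1 >-> R})
  d2 (T2 : measurableType d2) (Q : probability T2 R) (Y : {mfun T2 >-> R}) :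
  (0 <= W2 P X Q Y)%E.
Proof. exact: sqrte_ge0. Qed.

(** Quantiles commute with increasing maps. *)
Lemma quantile_stdz (rho delta : R) d (T : measurableType d) (P : probability T R)
  (X : {mfun T >-> R}) (z : R) : 0 < rho -> 0 < z < 1 ->
  quantile P (stdz rho delta \o X) z = stdz rho delta (quantile P X z).
Proof.
move=> rho0 z01.
have le_stdz x y : (stdz rho delta x <= y) = (x <= y / rho + mean_p rho delta).
  by rewrite /stdz mulrC -ler_pdivlMr// lerBlDr.
have E x : (quantile P (stdz rho delta \o X) z <= x) =
    (stdz rho delta (quantile P X z) <= x).
  rewrite le_stdz !quantile_le//; congr (_ <= _)%E.
  rewrite /cdf /distribution /pushforward; congr (P _).
  by apply/seteqP; split => w /=; rewrite !in_itv/= le_stdz.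
by apply/eqP; rewrite eq_le E lexx -E lexx.
Qed.

End W2_bounds.

Section matched_beta.
Context {R : realType} (rho delta : R) (rho0 : 0 < rho).
Context dZ (TZ : measurableType dZ) (PZ : probability TZ R) (Z : {RV PZ >-> R}).
Context dX (TX : measurableType dX) (PX : probability TX R) (X : {RV PX >-> R}).
Hypothesis Zcdf : forall y, 0 < y < 1 -> cdf Z y = (F_cdf rho delta y)%:E.
Hypothesis Xbeta : rbeta_distributed PX X (beta_a PZ rho delta Z) (beta_b PZ rho delta Z).
Notation p := (mean_p rho delta).
Notation qZ := (quantile PZ Z).
Notation qX := (quantile PX X).

Let v : R := fine 'V_PZ[Z].
Let M : R := p * (1 - p).
Let n : R := (M - v) / v.

Let v_gt0 : 0 < v := variance_gt0 rho0 Zcdf.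
Let v_lt : v < M := variance_lt rho0 Zcdf.
Let p0 : 0 < p := Phi_gt0 _.
Let p1 : p < 1 := Phi_lt1 _.
Let n_gt0 : 0 < n. Proof. by rewrite divr_gt0// subr_gt0. Qed.
Let M_gt0 : 0 < M. Proof. by rewrite mulr_gt0// subr_gt0. Qed.

Let Xlaw : rbeta_distributed PX X (p * n) ((1 - p) * n).
Proof. by rewrite /n !mulrA; exact: Xbeta. Qed.

Let vE : M / (n + 1) = v.
Proof.
have -> : n + 1 = M / v by rewrite /n mulrBl divff ?gt_eqF// subrK.
by rewrite invf_div mulrCA divff ?mulr1// gt_eqF.
Qed.

Let Z01 := quantile_probit01 rho0 Zcdf.
Let X01 := quantile_beta01 p0 p1 n_gt0 Xlaw.
Let Zmean := mean_probit_quantile rho0 Zcdf.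
Let Xmean := mean_beta p0 p1 n_gt0 Xlaw.
Let Zvar := variance_probit rho0 Zcdf.
Let Xvar : mean01 (fun z => (qX z - p) ^+ 2) = v.
Proof. by rewrite (variance_beta p0 p1 n_gt0 Xlaw) vE. Qed.

Let int01_diff : int01 (fun z => (qZ z - qX z) ^+ 2).
Proof.
apply: (@int01_bounded _ 1).
  by apply: measurable_funX; apply: measurable_funB; exact: measurable_quantile.
move=> z z01; rewrite normrX expr_le1//; exact: dist01_le1 (Z01 z01) (X01 z01).
Qed.

Lemma W2_le_variance : (W2 PZ Z PX X <= (Num.sqrt (4 * v))%:E)%E.
Proof.
have iZ := int01_quantile_sqrB Z01 p; have iX := int01_quantile_sqrB X01 p.
apply: W2_le => //.
have := le_mean01 int01_diff (int01D (int01Z 2 iZ) (int01Z 2 iX)).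
rewrite mean01D ?mean01Z -?Zvar ?Xvar//; [|exact: int01Z|exact: int01Z].
move=> h; apply: le_trans (h _) _; last by rewrite /v; lra.
by move=> z _; have := sqr_ge0 (qZ z - p + (qX z - p)); nra.
Qed.

(** Differences of points of ]0, 1[ dominate their squares, and both quantile
    functions are compared with the same Bernoulli quantile function. *)
Lemma W2_le_gap : (W2 PZ Z PX X <= (Num.sqrt (4 * (M - v)))%:E)%E.
Proof.
have pZ : 0 < mean01 qZ < 1 by rewrite Zmean p0.
have pX : 0 < mean01 qX < 1 by rewrite Xmean p0.
have [iZ hZ] := mean01_quantile_bernoulli Z01 pZ.
have [iX hX] := mean01_quantile_bernoulli X01 pX.
have [_ EZ] := mean01_mulB Z01; have [_ EX] := mean01_mulB X01.
rewrite EZ Zmean -Zvar -/v -/M in hZ; rewrite EX Xmean Xvar -/M in hX.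
rewrite Zmean in iZ; rewrite Xmean in iX.
apply: W2_le => //.
have := le_mean01 int01_diff (int01D iZ iX); rewrite mean01D// => h.
apply: le_trans (h _) _; last first.
  by apply: (le_trans (lerD hZ hX)); rewrite -mulrDl -natrD.
move=> z z01; apply: (@le_trans _ _ `|qZ z - qX z|).
  rewrite -real_normK ?num_real// expr2 ler_piMl//; exact: dist01_le1 (Z01 z01) (X01 z01).
by rewrite (distrC (qX z)); exact: ler_distD.
Qed.

(** The bound depends on [delta] only through [M]. *)
Lemma W2_stdz_le :
  (W2 PZ (stdz rho delta \o Z) PX (stdz rho delta \o X) <=
   (Num.sqrt (8 * mean01 (fun z => Phi_inv z ^+ 4) / rho ^+ 2 +
      4 * (rho^-1 + rho ^- 2) / M))%:E)%E.
Proof.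
set s := Num.sqrt v.
have hZ := probit_normal_approx rho0 Zcdf; rewrite -/v -/s in hZ.
have hX := beta_normal_approx p0 p1 n_gt0 Xlaw; rewrite -/M vE -/s in hX.
set K4 := mean01 (fun z => Phi_inv z ^+ 4) in hZ *.
have s_le : s <= rho^-1.
  rewrite -[rho^-1]gtr0_norm ?invr_gt0// -sqrtr_sqr ler_wsqrtr// exprVn.
  exact: (variance_le rho0 Zcdf).
have v_le : v <= rho ^- 2 by exact: (variance_le rho0 Zcdf).
have E z : 0 < z < 1 ->
    quantile PZ (stdz rho delta \o Z) z - quantile PX (stdz rho delta \o X) z =
    rho * (qZ z - qX z).
  by move=> z01; rewrite !quantile_stdz// /stdz; ring.
have E2 z : 0 < z < 1 -> rho ^+ 2 * (qZ z - qX z) ^+ 2 =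
    (quantile PZ (stdz rho delta \o Z) z - quantile PX (stdz rho delta \o X) z) ^+ 2.
  by move=> z01; rewrite E// exprMn.
apply: W2_le; first exact: eq_int01 E2 (int01Z _ int01_diff).
rewrite -(eq_mean01 E2) mean01Z//.
have r2 : 0 < rho ^+ 2 by rewrite exprn_gt0.
have ms := @measurable_Phi_inv R.
have mdev (q : R -> R) : measurable_fun `](0:R), (1:R)[ q ->
    (forall z, 0 < z < 1 -> 0 < q z < 1) -> int01 (fun z => (q z - p - s * Phi_inv z) ^+ 2).
  move=> mq q01.
  have mu' : measurable_fun `](0:R), (1:R)[ (fun z => q z - p) by exact: measurable_funB.
  have iu : int01 (fun z => (q z - p) ^+ 2).
    apply: (@int01_bounded _ 1); first exact: measurable_funX.
    by move=> z /q01 qz; rewrite normrX expr_le1// dist01_le1// p0.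
  have im2 := @integrable_Phi_inv2 R.
  by have [] := mean01_sqrB s iu (int01M mu' ms iu im2) im2.
have iZ := mdev _ (measurable_quantile Z) Z01.
have iX := mdev _ (measurable_quantile X) X01.
have := le_mean01 int01_diff (int01D (int01Z 2 iZ) (int01Z 2 iX)).
rewrite mean01D ?mean01Z//; [|exact: int01Z|exact: int01Z] => h.
have {}h : mean01 (fun z => (qZ z - qX z) ^+ 2) <=
    2 * (4 * K4 / rho ^+ 4) + 2 * (2 * v * (s + v) / M).
  apply: le_trans (h _) _; last by rewrite lerD// ler_pM2l.
  move=> z _; have := sqr_ge0 (qZ z - p - s * Phi_inv z + (qX z - p - s * Phi_inv z)).
  by nra.
rewrite -(ler_pM2l r2) in h; apply: (le_trans h).
have -> : rho ^+ 2 * (2 * (4 * K4 / rho ^+ 4) + 2 * (2 * v * (s + v) / M)) =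
  8 * K4 / rho ^+ 2 + 4 * (rho ^+ 2 * v * (s + v)) / M.
  have -> : rho ^+ 4 = rho ^+ 2 * rho ^+ 2 by rewrite -exprD.
  by move: (rho ^+ 2) r2 => r r0; field; rewrite !gt_eqF.
rewrite lerD2l ler_pM2r ?invr_gt0// ler_pM2l//.
have s0 : 0 <= s by exact: sqrtr_ge0.
apply: (@le_trans _ _ (1 * (s + v))); last by rewrite mul1r lerD.
rewrite ler_wpM2r ?addr_ge0// ?(ltW v_gt0)//.
by rewrite -ler_pdivlMl// mulr1.
Qed.

End matched_beta.

(** * Limits *)

Section limits.
Context {R : realType}.

Lemma cvge_sqrt0 (FF : set_system R) (W : R -> \bar R) (b : R -> R) : ProperFilter FF ->
  (\forall x \near FF, (0 <= W x <= (Num.sqrt (b x))%:E)%E) ->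
  b x @[x --> FF] --> (0 : R) -> W x @[x --> FF] --> 0%E.
Proof.
move=> PF Wb b0; apply: (squeeze_cvge Wb); first exact: cvg_cst.
apply: cvg_EFin; first exact: nearW.
rewrite -[X in _ --> X]sqrtr0.
by apply: (cvg_comp _ _ b0); exact: sqrt_continuous.
Qed.

Lemma cvgV_pinfty : (x^-1 : R) @[x --> +oo] --> (0 : R).
Proof.
by apply/gtr0_cvgV0; [exact: nbhs_pinfty_gt|exact: cvg_id].
Qed.

Let sqrt_gt0 (rho : R) : 0 < Num.sqrt (rho ^+ 2 + 1).
Proof. by rewrite sqrtr_gt0 ltr_wpDl// sqr_ge0. Qed.

Lemma mean_p_cvgNy (rho : R) : mean_p rho delta @[delta --> -oo] --> (1 : R).
Proof.
apply: (cvg_comp (fun delta => - delta / Num.sqrt (rho ^+ 2 + 1)) Phi _ Phi_cvgy).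
apply/cvgryPge => A; near=> x; rewrite ler_pdivlMr// lerNr.
by near: x; apply: nbhs_ninfty_le; rewrite num_real.
Unshelve. all: by end_near. Qed.

Lemma mean_p_cvgy (rho : R) : mean_p rho delta @[delta --> +oo] --> (0 : R).
Proof.
apply: (cvg_comp (fun delta => - delta / Num.sqrt (rho ^+ 2 + 1)) Phi _ Phi_cvgNy).
apply/cvgrNyPle => A; near=> x; rewrite ler_pdivrMr// lerNl.
by near: x; apply: nbhs_pinfty_ge; rewrite num_real.
Unshelve. all: by end_near. Qed.

Lemma mean_p_bounds (rho delta k : R) :
  `|delta| <= k * Num.sqrt (rho ^+ 2 + 1) -> Phi (- k) <= mean_p rho delta <= Phi k.
Proof.
by move=> h; rewrite !ler_Phi -ler_norml normrM normrN normfV (gtr0_norm (sqrt_gt0 rho))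
  ler_pdivrMr.
Qed.

End limits.

Section asymptotics.
Context {R : realType}
  (dZ dX : R -> R -> measure_display)
  (TZ : forall rho delta : R, measurableType (dZ rho delta))
  (TX : forall rho delta : R, measurableType (dX rho delta))
  (PZ : forall rho delta : R, probability (TZ rho delta) R)
  (PX : forall rho delta : R, probability (TX rho delta) R)
  (Z : forall rho delta : R, {RV (PZ rho delta) >-> R})
  (X : forall rho delta : R, {RV (PX rho delta) >-> R})
  (Z_cdf : forall rho delta y : R, 0 < rho -> 0 < y < 1 ->
     cdf (Z rho delta) y = (F_cdf rho delta y)%:E)
  (X_beta : forall rho delta : R, 0 < rho ->
     rbeta_distributed (PX rho delta) (X rho delta)
       (beta_a (PZ rho delta) rho delta (Z rho delta))
       (beta_b (PZ rho delta) rho delta (Z rho delta))).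
Let W rho delta := W2 (PZ rho delta) (Z rho delta) (PX rho delta) (X rho delta).
Let Ws rho delta :=
  W2 (PZ rho delta) (stdz rho delta \o Z rho delta)
     (PX rho delta) (stdz rho delta \o X rho delta).

Let W_le (rho delta b : R) : 0 < rho ->
  4 * fine 'V_(PZ rho delta)[Z rho delta] <= b -> (0 <= W rho delta <= (Num.sqrt b)%:E)%E.
Proof.
move=> rho0 vb; rewrite W2_ge0/=.
apply: (le_trans (W2_le_variance rho0 (fun y => @Z_cdf rho delta y rho0) (@X_beta rho delta rho0))).
by rewrite lee_fin ler_wsqrtr.
Qed.

Let W_le_mean (rho delta : R) : 0 < rho ->
  (0 <= W rho delta <= (Num.sqrt (4 * (mean_p rho delta * (1 - mean_p rho delta))))%:E)%E.
Proof.
move=> rho0; apply: W_le => //; rewrite ler_pM2l//.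
by apply: ltW; exact: (variance_lt rho0 (fun y => @Z_cdf rho delta y rho0)).
Qed.

Let W_le_rho (rho delta : R) : 0 < rho ->
  (0 <= W rho delta <= (Num.sqrt (4 * rho ^- 2))%:E)%E.
Proof.
move=> rho0; apply: W_le => //; rewrite ler_pM2l//.
exact: (variance_le rho0 (fun y => @Z_cdf rho delta y rho0)).
Qed.

Lemma W2_cvg_deltaNy (rho : R) : 0 < rho -> W rho delta @[delta --> -oo%R] --> 0%E.
Proof.
move=> rho0; apply: cvge_sqrt0.
  by apply: nearW => delta; exact: W_le_mean.
rewrite -[X in _ --> X](mulr0 4); apply: cvgMr.
have <- : 1 * (1 - 1) = 0 :> R by rewrite subrr mulr0.
have h := mean_p_cvgNy rho.
by apply: cvgM => //; apply: cvgB => //; exact: cvg_cst.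
Qed.

Lemma W2_cvg_deltay (rho : R) : 0 < rho -> W rho delta @[delta --> +oo%R] --> 0%E.
Proof.
move=> rho0; apply: cvge_sqrt0.
  by apply: nearW => delta; exact: W_le_mean.
rewrite -[X in _ --> X](mulr0 4); apply: cvgMr.
rewrite -[X in _ --> X](mul0r (1 - 0)).
have h := mean_p_cvgy rho.
by apply: cvgM => //; apply: cvgB => //; exact: cvg_cst.
Qed.

Let V2_cvg : (x ^- 2 : R) @[x --> +oo] --> (0 : R).
Proof.
have -> : (fun x : R => x ^- 2) = (fun x => x^-1 * x^-1).
  by apply/funext => x; rewrite expr2 invfM.
by rewrite -[X in _ --> X](mulr0 0); apply: cvgM; exact: cvgV_pinfty.
Qed.

Lemma W2_cvg_rhoy (delta : R -> R) : W rho (delta rho) @[rho --> +oo%R] --> 0%E.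
Proof.
apply: cvge_sqrt0.
  by near=> rho; apply: W_le_rho; near: rho; exact: nbhs_pinfty_gt.
by rewrite -[X in _ --> X](mulr0 4); apply: cvgMr.
Unshelve. all: by end_near. Qed.

(** Taking [t = 1 / sqrt rho] in [variance_gap_le]. *)
Lemma W2_cvg_rho0 (delta : R) : W rho delta @[rho --> 0^'+] --> 0%E.
Proof.
apply: (@cvge_sqrt0 _ _ _ (fun rho => 4 * (rho + 2 * Num.sqrt rho))).
  near=> rho; have rho0 : 0 < rho by near: rho; exact: nbhs_right_gt.
  rewrite W2_ge0/=.
  apply: (le_trans (W2_le_gap rho0 (fun y => @Z_cdf rho delta y rho0) (@X_beta rho delta rho0))).
  rewrite lee_fin ler_wsqrtr// ler_pM2l//.
  have s0 : 0 < Num.sqrt rho by rewrite sqrtr_gt0.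
  have t0 : 0 < (Num.sqrt rho)^-1 by rewrite invr_gt0.
  apply: (le_trans (variance_gap_le rho0 (fun y => @Z_cdf rho delta y rho0) t0)).
  rewrite -exprVn invrK sqr_sqrtr ?(ltW rho0)// lerD2l -mulrA ler_pM2l//.
  by rewrite -{1}(sqr_sqrtr (ltW rho0)) expr2 mulfK// gt_eqF.
rewrite -[X in _ --> X](mulr0 4); apply: cvgMr.
rewrite -[X in _ --> X](addr0 0) -[X in _ --> _ + X](mulr0 2).
apply: cvg_at_right_filter; apply: cvgD; first exact: cvg_id.
apply: cvgMr; rewrite -[X in _ --> X](sqrtr0 R); exact: sqrt_continuous.
Unshelve. all: by end_near. Qed.

(** The condition on [delta] keeps [mean_p] between [Phi (- k)] and [Phi k], away
    from 0 and from 1. *)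
Lemma W2_stdz_cvg_rhoy (delta : R -> R) (k : R) :
  (\forall rho \near +oo, `|delta rho| <= k * Num.sqrt (rho ^+ 2 + 1)) ->
  Ws rho (delta rho) @[rho --> +oo%R] --> 0%E.
Proof.
move=> delta_le.
set K4 : R := mean01 (fun z => Phi_inv z ^+ 4).
pose m := Phi (- k) * (1 - Phi k).
have m0 : 0 < m by rewrite mulr_gt0 ?Phi_gt0// subr_gt0 Phi_lt1.
apply: (@cvge_sqrt0 _ _ _ (fun rho => 8 * K4 * rho ^- 2 + 4 * (rho^-1 + rho ^- 2) * m^-1)).
  near=> rho; have rho0 : 0 < rho by near: rho; exact: nbhs_pinfty_gt.
  rewrite W2_ge0/=.
  apply: (le_trans (W2_stdz_le rho0 (fun y => @Z_cdf rho (delta rho) y rho0)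
    (@X_beta rho (delta rho) rho0))).
  have /mean_p_bounds/andP[pk kp] : `|delta rho| <= k * Num.sqrt (rho ^+ 2 + 1).
    by near: rho.
  rewrite lee_fin ler_wsqrtr// -/K4 lerD2l.
  have p0 : 0 < mean_p rho (delta rho) by exact: Phi_gt0.
  have p1 : mean_p rho (delta rho) < 1 by exact: Phi_lt1.
  rewrite ler_pM2l ?mulr_gt0 ?addr_gt0 ?invr_gt0 ?exprn_gt0//.
  rewrite lef_pV2 ?posrE ?mulr_gt0 ?subr_gt0 ?Phi_gt0 ?Phi_lt1//.
  by apply: ler_pM; rewrite ?(ltW (Phi_gt0 _)) ?subr_ge0 ?(ltW (Phi_lt1 _))// lerD2l lerN2.
rewrite -[X in _ --> X](addr0 0).
apply: cvgD; first by rewrite -[X in _ --> X](mulr0 (8 * K4)); exact: cvgMr.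
rewrite -[X in _ --> X](mul0r m^-1); apply: cvgMl.
rewrite -[X in _ --> X](mulr0 4); apply: cvgMr.
by rewrite -[X in _ --> X](addr0 0); apply: cvgD => //; exact: cvgV_pinfty.
Unshelve. all: by end_near. Qed.

End asymptotics.

Theorem corollary2p5 (R : realType)
  (dZ dX : R -> R -> measure_display)
  (TZ : forall rho delta : R, measurableType (dZ rho delta))
  (TX : forall rho delta : R, measurableType (dX rho delta))
  (PZ : forall rho delta : R, probability (TZ rho delta) R)
  (PX : forall rho delta : R, probability (TX rho delta) R)
  (Z : forall rho delta : R, {RV (PZ rho delta) >-> R})
  (X : forall rho delta : R, {RV (PX rho delta) >-> R})
  (Z_cdf : forall rho delta y : R, 0 < rho -> 0 < y < 1 ->
     cdf (Z rho delta) y = (F_cdf rho delta y)%:E)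
  (X_beta : forall rho delta : R, 0 < rho ->
     rbeta_distributed (PX rho delta) (X rho delta)
       (beta_a (PZ rho delta) rho delta (Z rho delta))
       (beta_b (PZ rho delta) rho delta (Z rho delta))) :
  let W rho delta :=
    W2 (PZ rho delta) (Z rho delta) (PX rho delta) (X rho delta) in
  let Ws rho delta :=
    W2 (PZ rho delta) (stdz rho delta \o Z rho delta)
       (PX rho delta) (stdz rho delta \o X rho delta) in
  (forall rho : R, 0 < rho -> W rho delta @[delta --> -oo%R] --> 0%E) /\
  (forall delta : R, W rho delta @[rho --> +oo%R] --> 0%E) /\
  (forall r : R, r != 0 -> W rho (r * rho) @[rho --> +oo%R] --> 0%E) /\
  (forall rho : R, 0 < rho -> W rho delta @[delta --> +oo%R] --> 0%E) /\
  (forall delta : R, W rho delta @[rho --> 0^'+] --> 0%E) /\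
  (forall delta : R, Ws rho delta @[rho --> +oo%R] --> 0%E) /\
  (forall r : R, r != 0 -> Ws rho (r * rho) @[rho --> +oo%R] --> 0%E).
Proof.
move=> W Ws.
have sqrt_ge1 (rho : R) : 1 <= Num.sqrt (rho ^+ 2 + 1).
  by rewrite -[leLHS]sqrtr1 ler_wsqrtr// lerDr sqr_ge0.
have sqrt_ge (rho : R) : `|rho| <= Num.sqrt (rho ^+ 2 + 1).
  by rewrite -sqrtr_sqr ler_wsqrtr// lerDl.
split; first by move=> rho; exact: W2_cvg_deltaNy.
split; first by move=> delta; exact: (W2_cvg_rhoy Z_cdf X_beta (fun=> delta)).
split; first by move=> r _; exact: (W2_cvg_rhoy Z_cdf X_beta (fun rho => r * rho)).
split; first by move=> rho; exact: W2_cvg_deltay.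
split; first by move=> delta; exact: W2_cvg_rho0.
split.
  move=> delta; apply: (W2_stdz_cvg_rhoy Z_cdf X_beta (delta := fun=> delta) (k := `|delta|)).
  by apply: nearW => rho; rewrite ler_peMr.
move=> r _; apply: (W2_stdz_cvg_rhoy Z_cdf X_beta (delta := fun rho => r * rho) (k := `|r|)).
by apply: nearW => rho; rewrite normrM ler_wpM2l.
Qed.
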